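(* Let $g=(g_1,\dots,g_m)$ be a tuple of polynomials in $\mathbb R[x]$, $x=(x_1,\dots,x_n)$, and $S=\{x\in\mathbb R^n: g_j(x)\ge0,\ j=1,\dots,m\}$. Suppose $f,g_1,\dots,g_m$ are homogeneous polynomials of even degrees such that $f\ge0$ on $S$. If the LICQC, SCC and SOSC hold at every minimizer of the problem $$\min\ f(x)\quad\text{s.t.}\quad g_j(x)\ge0\ (j=1,\dots,m),\quad \|x\|^2-1=0,$$ then $\|x\|^{2k}f\in\mathrm{QM}[g]$ for some $k\in\mathbb N$.
   Context: ''Minimizer'' means global minimizer. $\mathrm{QM}[g]=\Sigma[x]+g_1\Sigma[x]+\cdots+g_m\Sigma[x]$, where $\Sigma[x]$ is the set of sums of squares of real polynomials in $x$; $\|\cdot\|$ is the Euclidean norm. **Optimality conditions.** For a problem $\min\phi(u)$ s.t. $h_i(u)=0\ (i\in E)$, $h_j(u)\ge0\ (j\in I)$ and a local minimizer $u^*$, let $J(u^* )=\{i\in E\cup I: h_i(u^* )=0\}$. LICQC: the gradients $\nabla h_i(u^* )$, $i\in J(u^* )$, are linearly independent. Under LICQC there are unique multipliers $\lambda_i$ with $\nabla\phi(u^* )=\sum_{i\in E\cup I}\lambda_i\nabla h_i(u^* )$, $\lambda_j\ge0$ and $\lambda_jh_j(u^* )=0$ for $j\in I$. SCC: $\lambda_j+h_j(u^* )>0$ for all $j\in I$. SOSC: $v^T\nabla^2\mathscr L(u^* )v>0$ for all $v\ne0$ orthogonal to all $\nabla h_i(u^* )$, $i\in J(u^* )$, where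 $\mathscr L=\phi-\sum_i\lambda_ih_i$. *)

(* Defs.v *)
From mathcomp Require Import all_boot all_order all_algebra.
From mathcomp Require Import reals.
From mathcomp Require Import mpoly.

Set Implicit Arguments.
Unset Strict Implicit.
Unset Printing Implicit Defensive.

Import Order.TTheory GRing.Theory Num.Theory.

Local Open Scope ring_scope.

Section PolynomialsAtPoints.
Variables (R : realType) (n : nat).
Implicit Types (p : {mpoly R[n]}) (u : 'rV[R]_n).

Definition peval p u : R := p.@[fun i => u 0 i].

Definition gradient p u : 'rV[R]_n := \row_i peval p^`M(i) u.

Definition hessian p u : 'M[R]_n := \matrix_(i, j) peval p^`M(i)^`M(j) u.

Definition sqnorm : {mpoly R[n]} := \sum_(i < n) 'X_i ^+ 2.

(* The zero polynomial is homogeneous of every degree, so it is an even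
   form. *)
Definition even_form p : Prop := exists2 d : nat, ~~ odd d & p \is d.-homog.

Definition sos p : Prop := exists s : seq {mpoly R[n]}, p = \sum_(q <- s) q ^+ 2.

Definition quadratic_module (m : nat) (g : m.-tuple {mpoly R[n]}) p : Prop :=
  exists (s0 : {mpoly R[n]}) (s : 'I_m -> {mpoly R[n]}),
    [/\ sos s0, forall j, sos (s j)
      & p = s0 + \sum_(j < m) tnth g j * s j].

Definition basic_closed_set (m : nat) (g : m.-tuple {mpoly R[n]}) u : Prop :=
  forall j, 0 <= peval (tnth g j) u.

End PolynomialsAtPoints.

(* min phi(u) subject to h_i(u) = 0 for i in E and h_j(u) >= 0 for j in I.
   The constraints form one family on E + I: [inl] marks the equalities and
   [inr] the inequalities. *)
Section OptimalityConditions.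
Variables (R : realType) (n : nat) (E I : finType).
Variables (phi : {mpoly R[n]}) (h : E + I -> {mpoly R[n]}).
Implicit Types (u v : 'rV[R]_n) (lam : E + I -> R).

Definition feasible u : Prop :=
  (forall i : E, peval (h (inl i)) u = 0) /\
  (forall j : I, 0 <= peval (h (inr j)) u).

Definition minimizer u : Prop :=
  feasible u /\ forall v, feasible v -> peval phi u <= peval phi v.

Definition active u : {set E + I} := [set i | peval (h i) u == 0].

Definition LICQC u : Prop :=
  free [seq gradient (h i) u | i <- enum (active u)].

Definition multipliers u lam : Prop :=
  [/\ gradient phi u = \sum_i lam i *: gradient (h i) u,
      forall j : I, 0 <= lam (inr j)
    & forall j : I, lam (inr j) * peval (h (inr j)) u = 0].

(* At a local minimizer satisfying LICQC the multipliers exist and are unique,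
   so the universal quantifier over lam in SCC and SOSC has exactly one
   instance. *)
Definition SCC u : Prop :=
  forall lam, multipliers u lam ->
  forall j : I, 0 < lam (inr j) + peval (h (inr j)) u.

Definition lagrangian lam : {mpoly R[n]} := phi - \sum_i lam i *: h i.

Definition SOSC u : Prop :=
  forall lam, multipliers u lam ->
  forall v, v != 0 ->
    (forall i, i \in active u -> gradient (h i) u *m v^T = 0) ->
    0 < (v *m hessian (lagrangian lam) u *m v^T) 0 0.

End OptimalityConditions.

Definition sphere_constraints (R : realType) (n m : nat)
    (g : m.-tuple {mpoly R[n]}) (i : unit + 'I_m) : {mpoly R[n]} :=
  match i with
  | inl _ => sqnorm R n - 1
  | inr j => tnth g j
  end.

(* Main.v *)
(* Let K be the intersection of S with the unit sphere; the claim reduces to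
   writing f on the sphere as s_0 + sum_j g_j s_j with sums of squares s_j,
   since averaging such an identity over x and -x and homogenizing it (all
   degrees are even) yields the theorem.  If f > 0 on K it is a Putinar-type
   statement.  Otherwise the minimizers are the zeros of f on K.

   By homogeneity f >= 0 on the whole cone S, which under LICQC gives
   multipliers, with multiplier 0 for the sphere.  SCC and SOSC then imply that
   f - sum_j a_j^2 (1 - g_j/N)^(2k) g_j, with a_j^2 = lambda_j for active j, has
   a strict quadratic growth on the sphere at such a zero once k is large.  In
   particular the zeros are isolated, hence finitely many; multiplying by
   complementary peaked polynomials p and 1 - p separates them, so that F may
   be assumed to have a single zero z on K.  As k grows the damped expression
   above increases pointwise on the sphere and becomes positive off z.

   It remains to see that a polynomial F >= 0 on the sphere whose only zero z is
   nondegenerate is a sum of squares there.  Write F = h^T S h with h = x - z;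
   adding to S a large multiple of a semidefinite matrix B with h^T B h = 0 on
   the sphere makes S(x) positive definite on a cube, and a matrix version of
   Polya's theorem in the variables (1 +- x_i)/(2n), which are sums of squares on
   the sphere, expresses S as a sum of squares. *)

(* A scalar Polya or Putinar argument needs strict positivity, which fails at a zero [z]. Writing
   [F] as a quadratic form in [x - z] moves the positivity to the matrix of that form, which is not
   unique: on the sphere only its value in the direction [x - z] counts. Away from [z] that
   direction is positive because [F] is, at [z] the tangent directions are positive by
   nondegeneracy, and the multiple of [B] takes care of the rest. The cube appears because the
   simplex of the Polya variables is sent into it and not into the sphere.

   The exponent [k] does two things. At [z] each active constraint adds to the Hessian a multiple of
   [k] times the squared derivative of [g_j], which extends positivity from the directions of SOSC
   to the whole tangent space of the sphere. Away from [z] the subtracted terms fade where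
   [g_j >= 0] and become arbitrarily large gains where [g_j < 0]; monotonicity in [k] lets
   compactness choose one exponent, as in Dini's theorem. The zeros are split with corrections that
   are quadratically small at the zeros kept, so that the growth there survives. *)
Require Import Defs.
From mathcomp Require Import all_boot all_order all_algebra.
From mathcomp Require Import reals.
From mathcomp Require Import mpoly.
From mathcomp Require Import ring lra zify.

Set Implicit Arguments.
Unset Strict Implicit.
Unset Printing Implicit Defensive.

Import Order.TTheory GRing.Theory Num.Theory.

Local Open Scope ring_scope.

(** * Compactness *)

Section Compactness.
Variable R : realType.

(** Heine-Borel as an induction principle, which avoids explicit finite subcovers. The supremum of
    the points reached from [a] can be passed by its own neighbourhood unless it is already [b]. *)
Lemma interval_cover_ind (P : (R -> Prop) -> Prop) :
  (forall A B : R -> Prop, (forall t, A t -> B t) -> P B -> P A) ->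
  (forall A B, P A -> P B -> P (fun t => A t \/ B t)) ->
  (forall t, exists2 r : R, 0 < r & P (fun s => `|s - t| < r)) ->
  forall a b, P (fun t => a <= t <= b).
Proof.
move=> mono union loc a b.
have [ltba|leab] := ltP b a.
  have [r r0 Pr] := loc a; apply: mono Pr => t /= /andP[at_ tb]; exfalso; lra.
pose E : classical_sets.set R := fun c => a <= c <= b /\ P (fun t => a <= t <= c).
have Ea : E a.
  split; first by rewrite lexx.
  have [r r0 Pr] := loc a; apply: mono Pr => t /= /andP[at_ ta].
  have -> : t = a by apply: le_anti; rewrite ta.
  by rewrite subrr normr0.
have supE : classical_sets.has_sup E.
  by split; [exists a | exists b => c [/andP[]]].
have sup_ge : a <= sup E by apply: sup_upper_bound.
have sup_le : sup E <= b.
  by apply: sup_le_ub; [exists a | move=> c [/andP[]]].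
have [r r0 Pr] := loc (sup E).
have [c [/andP[ac cb] Pc] ltc] := sup_adherent r0 supE.
have Pbig d : d < sup E + r -> P (fun t => a <= t <= d).
  move=> ltd; apply: mono (union _ _ Pc Pr) => t /= /andP[at_ td].
  have [tc|ct] := leP t c; [left; lra | right].
  by rewrite ltr_norml; lra.
have [ltb|geb] := ltP b (sup E + r); first exact: Pbig.
have : E (sup E + r / 2).
  by split; [apply/andP; split; lra | apply: Pbig; lra].
by move/(sup_upper_bound supE); lra.
Qed.

Variable n : nat.
Implicit Types (u v x z : 'rV[R]_n) (A B X : 'rV[R]_n -> Prop).

Definition near x (r : R) u := forall i, `|u 0 i - x 0 i| < r.
Definition box (r : R) u := forall i, `|u 0 i| <= r.
Definition closed_set X :=
  forall x, ~ X x -> exists2 r : R, 0 < r & forall u, near x r u -> ~ X u.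

Lemma near_le x (r s : R) u : r <= s -> near x r u -> near x s u.
Proof. by move=> rs xu i; apply: lt_le_trans rs. Qed.

Lemma box_cover_ind (P : ('rV[R]_n -> Prop) -> Prop) :
  (forall A B, (forall u, A u -> B u) -> P B -> P A) ->
  (forall A B, P A -> P B -> P (fun u => A u \/ B u)) ->
  (forall x, exists2 r : R, 0 < r & P (near x r)) ->
  forall s, P (box s).
Proof.
move=> mono union loc s.
(* The cover is made uniform one coordinate at a time. *)
suff H k : forall x, exists2 r : R, 0 < r &
    P (fun u => box s u /\ forall i : 'I_n, (k <= i)%N -> `|u 0 i - x 0 i| < r).
  have [r r0] := H n 0; apply: mono => u bu; split=> // i.
  by rewrite leqNgt ltn_ord.
elim: k => [|k IH] x.
  by have [r r0 Pr] := loc x; exists r => //; apply: mono Pr => u [_ xu] i; apply: xu.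
have [kn|nk] := ltnP k n; last first.
  have [r r0 Pr] := IH x; exists r => //; apply: mono Pr => u [bu xu].
  by split=> // i ki; have := ltn_ord i; lia.
pose k0 := Ordinal kn.
pose Q (A : R -> Prop) := exists2 r : R, 0 < r & P (fun u => [/\ box s u, A (u 0 k0)
  & forall i : 'I_n, (k < i)%N -> `|u 0 i - x 0 i| < r]).
have [|||r r0 Pr] := @interval_cover_ind Q _ _ _ (- s) s.
- move=> A B AB [r r0 Pr]; exists r => //; apply: mono Pr => u [bu Au xu].
  by split=> //; apply: AB.
- move=> A B [r r0 Pr] [r' r'0 Pr']; exists (Num.min r r').
    by rewrite lt_min r0.
  apply: mono (union _ _ Pr Pr') => u [bu [Au|Bu] xu]; [left|right].
    by split=> // i /xu; rewrite lt_min => /andP[].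
  by split=> // i /xu; rewrite lt_min => /andP[].
- move=> t; have [r r0 Pr] := IH (\row_i if i == k0 then t else x 0 i).
  exists r => //; exists r => //; apply: mono Pr => u [bu ut xu]; split=> // i.
  rewrite mxE leq_eqVlt => /orP[/eqP ki|ki].
    by have -> : i = k0 by [apply/val_inj]; rewrite eqxx.
  by case: eqP ki => [->|_ ki]; [rewrite ltnn | apply: xu].
exists r => //; apply: mono Pr => u [bu xu]; split=> //.
by rewrite -ler_norml.
Qed.

(** A point outside [X] has a neighbourhood missing [X], where [P] holds by its value on the empty
    set. Uniform constants and the finiteness of the zeros are obtained below by a choice of [P]. *)
Lemma compact_ind (X : 'rV[R]_n -> Prop) s (P : ('rV[R]_n -> Prop) -> Prop) :
  (forall u, X u -> box s u) -> closed_set X ->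
  (forall A B, (forall u, A u -> B u) -> P B -> P A) ->
  (forall A B, P A -> P B -> P (fun u => A u \/ B u)) ->
  P (fun=> False) ->
  (forall x, X x -> exists2 r : R, 0 < r & P (fun u => X u /\ near x r u)) ->
  P X.
Proof.
move=> Xb Xc mono union P0 loc.
suff: P (fun u => X u /\ box s u).
  by apply: mono => u Xu; split=> //; apply: Xb.
apply: (@box_cover_ind (fun A => P (fun u => X u /\ A u))).
- by move=> A B AB; apply: mono => u [Xu /AB].
- move=> A B PA PB; apply: mono (union _ _ PA PB) => u [Xu [Au|Bu]].
    by left.
  by right.
- move=> x; have [/loc //|nXx] := boolp.EM (X x).
  have [r r0 Hr] := Xc x nXx; exists r => //; apply: mono P0 => u [Xu /Hr].
  by apply.
Qed.

End Compactness.

(** * Vectors, quadratic forms and polynomials *)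

Section Vectors.
Variables (R : realType) (n : nat).
Implicit Types (u v w x z : 'rV[R]_n) (C D : 'I_n -> 'I_n -> R).

Definition dot u v : R := \sum_i u 0 i * v 0 i.

Lemma dotC u v : dot u v = dot v u.
Proof. by apply: eq_bigr => i _; rewrite mulrC. Qed.

Lemma dotDl u v w : dot (u + v) w = dot u w + dot v w.
Proof. by rewrite -big_split; apply: eq_bigr => i _; rewrite mxE mulrDl. Qed.

Lemma dotZl a u w : dot (a *: u) w = a * dot u w.
Proof. by rewrite mulr_sumr; apply: eq_bigr => i _; rewrite mxE mulrA. Qed.

Lemma dotNl u w : dot (- u) w = - dot u w.
Proof. by rewrite -scaleN1r dotZl mulN1r. Qed.

Lemma dotBl u v w : dot (u - v) w = dot u w - dot v w.
Proof. by rewrite dotDl dotNl. Qed.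

Lemma dotDr u v w : dot w (u + v) = dot w u + dot w v.
Proof. by rewrite !(dotC w) dotDl. Qed.

Lemma dotZr a u w : dot w (a *: u) = a * dot w u.
Proof. by rewrite !(dotC w) dotZl. Qed.

Lemma dotNr u w : dot w (- u) = - dot w u.
Proof. by rewrite !(dotC w) dotNl. Qed.

Lemma dotBr u v w : dot w (u - v) = dot w u - dot w v.
Proof. by rewrite !(dotC w) dotBl. Qed.

Definition dotE := (dotDl, dotZl, dotNl, dotDr, dotZr, dotNr).

Lemma dot0l u : dot 0 u = 0.
Proof. by rewrite -(scale0r 0) dotZl mul0r. Qed.

Lemma dot_ge0 u : 0 <= dot u u.
Proof. by apply: sumr_ge0 => i _; rewrite -expr2 sqr_ge0. Qed.

Lemma dot_eq0 u : (dot u u == 0) = (u == 0).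
Proof.
apply/idP/eqP => [|->]; last by rewrite dot0l.
rewrite psumr_eq0 => [/allP u0|i _]; last by rewrite -expr2 sqr_ge0.
apply/rowP => i; rewrite mxE; apply/eqP.
by have := u0 i (mem_index_enum i); rewrite mulf_eq0 orbb.
Qed.

Lemma dot_gt0 u : (0 < dot u u) = (u != 0).
Proof. by rewrite lt0r dot_ge0 dot_eq0 andbT. Qed.

Lemma Lagrange_identity u v :
  dot (dot u u *: v - dot u v *: u) (dot u u *: v - dot u v *: u) =
  dot u u * (dot u u * dot v v - dot u v ^+ 2).
Proof. by rewrite !dotE (dotC v u); ring. Qed.

Lemma Cauchy_Schwarz u v : dot u v ^+ 2 <= dot u u * dot v v.
Proof.
have [->|u0] := eqVneq u 0; first by rewrite !dot0l expr0n mul0r.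
by rewrite -subr_ge0 -(pmulr_rge0 _ (_ : 0 < dot u u)) ?dot_gt0 //
           -Lagrange_identity dot_ge0.
Qed.

Lemma Cauchy_Schwarz_eq u v : u != 0 ->
  dot u u * dot v v = dot u v ^+ 2 -> v = (dot u v / dot u u) *: u.
Proof.
move=> u0 uv; have uu0 : dot u u != 0 by rewrite dot_eq0.
have /eqP := Lagrange_identity u v; rewrite uv subrr mulr0 dot_eq0 subr_eq0.
move/eqP => E; apply: (scalerI uu0); rewrite E scalerA.
by rewrite mulrCA divff // mulr1.
Qed.

Lemma sqr_coord_le u i : u 0 i ^+ 2 <= dot u u.
Proof.
by rewrite /dot (bigD1 i) //= -expr2 lerDl sumr_ge0 // => j _; rewrite -expr2 sqr_ge0.
Qed.

Lemma near_dot x (r : R) u : near x r u -> dot (u - x) (u - x) <= n%:R * r ^+ 2.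
Proof.
move=> xu; have -> : n%:R * r ^+ 2 = \sum_(i < n) r ^+ 2.
  by rewrite sumr_const card_ord mulr_natl.
apply: ler_sum => i _; have h := ltW (xu i).
rewrite !mxE -expr2 -real_normK ?num_real // lerXn2r // ?nnegrE //.
exact: le_trans h.
Qed.

Lemma dot_near (e : R) : 0 < e ->
  exists2 r : R, 0 < r & forall x u, near x r u -> dot (u - x) (u - x) < e.
Proof.
move=> e0; exists (Num.sqrt (e / n.+1%:R)).
  by rewrite sqrtr_gt0 divr_gt0 ?ltr0n.
move=> x u /near_dot /le_lt_trans; apply.
rewrite sqr_sqrtr ?divr_ge0 ?ler0n ?ltW //.
rewrite mulrCA -[X in _ < X]mulr1 ltr_pM2l // ltr_pdivrMr ?ltr0n //.
by rewrite mul1r ltr_nat.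
Qed.

Lemma near_of_dot x (r : R) u : 0 < r -> dot (u - x) (u - x) < r ^+ 2 -> near x r u.
Proof.
move=> r0 xu i; have := le_lt_trans (sqr_coord_le (u - x) i) xu.
by rewrite !mxE => h; rewrite -(@ltr_pXn2r _ 2) ?nnegrE ?(ltW r0) // real_normK ?num_real.
Qed.

Definition qform C v : R := \sum_a \sum_b v 0 a * v 0 b * C a b.

Lemma qformZ C a v : qform C (a *: v) = a ^+ 2 * qform C v.
Proof.
rewrite /qform mulr_sumr; apply: eq_bigr => i _; rewrite mulr_sumr.
by apply: eq_bigr => j _; rewrite !mxE; ring.
Qed.

Lemma qformD C D v : qform (fun a b => C a b + D a b) v = qform C v + qform D v.
Proof.
rewrite /qform -big_split; apply: eq_bigr => i _; rewrite -big_split.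
by apply: eq_bigr => j _; rewrite mulrDr.
Qed.

Lemma qform_scale C c v : qform (fun a b => c * C a b) v = c * qform C v.
Proof.
rewrite /qform mulr_sumr; apply: eq_bigr => i _; rewrite mulr_sumr.
by apply: eq_bigr => j _; rewrite mulrCA.
Qed.

Lemma qform_sum (I : finType) (P : pred I) (F : I -> 'I_n -> 'I_n -> R) v :
  qform (fun a b => \sum_(i | P i) F i a b) v = \sum_(i | P i) qform (F i) v.
Proof.
rewrite /qform [RHS]exchange_big /=; apply: eq_bigr => a _.
rewrite [RHS]exchange_big /=; apply: eq_bigr => b _.
by rewrite mulr_sumr.
Qed.

Lemma qform_rank1 w v : qform (fun a b => w 0 a * w 0 b) v = dot w v ^+ 2.
Proof.
rewrite expr2 /dot mulr_suml; apply: eq_bigr => i _; rewrite mulr_sumr.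
by apply: eq_bigr => j _; ring.
Qed.

Lemma qform_id v : qform (fun a b => (a == b)%:R) v = dot v v.
Proof.
apply: eq_bigr => i _; rewrite (bigD1 i) //= eqxx mulr1 big1 ?addr0 // => j.
by rewrite eq_sym => /negPf ->; rewrite mulr0.
Qed.

Lemma eq_qform C D v : (forall a b, C a b = D a b) -> qform C v = qform D v.
Proof. by move=> CD; apply: eq_bigr => a _; apply: eq_bigr => b _; rewrite CD. Qed.

Lemma qform_bound C v :
  `|qform C v| <= (\sum_a \sum_b `|C a b|) * dot v v.
Proof.
apply: le_trans (ler_norm_sum _ _ _) _; rewrite mulr_suml; apply: ler_sum => a _.
apply: le_trans (ler_norm_sum _ _ _) _; rewrite mulr_suml; apply: ler_sum => b _.
rewrite normrM mulrC ler_wpM2l // normrM.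
have := sqr_coord_le v a; have := sqr_coord_le v b.
rewrite -(real_normK (num_real (v 0 a))) -(real_normK (num_real (v 0 b))).
by have := sqr_ge0 (`|v 0 a| - `|v 0 b|) => *; nra.
Qed.

End Vectors.

Section Polynomials.
Variables (R : realType) (n : nat).
Implicit Types (p q : {mpoly R[n]}) (u v x z : 'rV[R]_n).

Lemma mpoly_ring_ind (P : {mpoly R[n]} -> Prop) :
  (forall c, P c%:MP) -> (forall i, P 'X_i) ->
  (forall p q, P p -> P q -> P (p + q)) ->
  (forall p q, P p -> P q -> P (p * q)) -> forall p, P p.
Proof.
move=> PC PX PD PM; elim/mpolyind => [|c m p _ _ Pp].
  by have := PC 0; rewrite mpolyC0.
apply: (PD) => //; rewrite -mul_mpolyC; apply: (PM) => //.
rewrite mpolyXE_id; apply: (big_ind P) => [|*|i _]; [|exact: PM|].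
  by have := PC 1; rewrite mpolyC1.
elim: (m i) => [|k IH]; first by have := PC 1; rewrite mpolyC1.
by rewrite exprS; apply: PM.
Qed.

Lemma pevalD p q u : peval (p + q) u = peval p u + peval q u.
Proof. exact: mevalD. Qed.
Lemma pevalN p u : peval (- p) u = - peval p u.
Proof. exact: mevalN. Qed.
Lemma pevalB p q u : peval (p - q) u = peval p u - peval q u.
Proof. exact: mevalB. Qed.
Lemma pevalM p q u : peval (p * q) u = peval p u * peval q u.
Proof. exact: mevalM. Qed.
Lemma pevalZ c p u : peval (c *: p) u = c * peval p u.
Proof. exact: mevalZ. Qed.
Lemma pevalC c u : peval c%:MP u = c.
Proof. exact: mevalC. Qed.
Lemma peval0 u : peval 0 u = 0.
Proof. exact: meval0. Qed.
Lemma peval1 u : peval 1 u = 1.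
Proof. exact: meval1. Qed.
Lemma pevalXU i u : peval 'X_i u = u 0 i.
Proof. exact: mevalXU. Qed.
Lemma pevalXn p k u : peval (p ^+ k) u = peval p u ^+ k.
Proof. exact: rmorphXn. Qed.
Lemma peval_sum (I : Type) (s : seq I) (P : pred I) (F : I -> {mpoly R[n]}) u :
  peval (\sum_(i <- s | P i) F i) u = \sum_(i <- s | P i) peval (F i) u.
Proof. exact: raddf_sum. Qed.
Definition pevalE :=
  (pevalD, pevalB, pevalN, pevalM, pevalZ, pevalC, peval0, peval1, pevalXU, pevalXn).

Lemma peval_sqnorm u : peval (sqnorm R n) u = dot u u.
Proof. by rewrite peval_sum; apply: eq_bigr => i _; rewrite !pevalE expr2. Qed.

Lemma poly_cont p x (e : R) : 0 < e ->
  exists2 r : R, 0 < r & forall u, near x r u -> `|peval p u - peval p x| < e.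
Proof.
elim/mpoly_ring_ind: p e => [c|i|p q IHp IHq|p q IHp IHq] e e0.
- by exists 1 => // u _; rewrite !pevalC subrr normr0.
- by exists e => // u xu; rewrite !pevalXU.
- have e2 : 0 < e / 2 by rewrite divr_gt0.
  have [r r0 Hr] := IHp _ e2; have [s s0 Hs] := IHq _ e2.
  exists (Num.min r s) => [|u xu]; first by rewrite lt_min r0.
  have := Hr u (near_le _ xu); have := Hs u (near_le _ xu).
  rewrite !ge_min !lexx orbT !pevalE !ltr_norml => /(_ isT)/andP[? ?] /(_ isT)/andP[? ?]; lra.
set a := peval p x; set b := peval q x.
pose K := `|a| + `|b| + 1; have K0 : 0 < K by rewrite /K; have := normr_ge0 a; have := normr_ge0 b => *; lra.
pose d := Num.min 1 (e / (2 * K)).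
have d0 : 0 < d by rewrite lt_min ltr01 divr_gt0 // mulr_gt0.
have [r r0 Hr] := IHp _ d0; have [s s0 Hs] := IHq _ d0.
exists (Num.min r s) => [|u xu]; first by rewrite lt_min r0.
have := Hr u (near_le _ xu); have := Hs u (near_le _ xu).
rewrite !ge_min !lexx orbT pevalM -/a -/b => /(_ isT) hb /(_ isT) ha.
have -> : peval (p * q) x = a * b by rewrite pevalM.
have -> : peval p u * peval q u - a * b =
  (peval p u - a) * (peval q u - b) + a * (peval q u - b) + b * (peval p u - a) by ring.
have dK : d * (2 * K) <= e by rewrite -ler_pdivlMr ?mulr_gt0 // /d ge_min lexx orbT.
have d1 : d <= 1 by rewrite /d ge_min lexx.
apply: le_lt_trans (ler_normD _ _) _.
apply: le_lt_trans (lerD (ler_normD _ _) (lexx _)) _; rewrite !normrM.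
set s1 := `|peval p u - a| in ha *; set s2 := `|peval q u - b| in hb *.
have h1 : s1 * s2 <= 1 * d by apply: ler_pM; rewrite ?normr_ge0 // /s1 ltW // (lt_le_trans ha).
have h2 : `|a| * s2 <= `|a| * d by rewrite ler_wpM2l ?normr_ge0 // ltW.
have h3 : `|b| * s1 <= `|b| * d by rewrite ler_wpM2l ?normr_ge0 // ltW.
apply: le_lt_trans (_ : _ <= d * K) _; first by rewrite /K; lra.
have dK0 : 0 < d * K by rewrite mulr_gt0.
lra.
Qed.

Lemma poly_bounded p (s : R) :
  exists2 C : R, 0 < C & forall u, box s u -> `|peval p u| <= C.
Proof.
elim/mpoly_ring_ind: p => [c|i|p q [C C0 HC] [D D0 HD]|p q [C C0 HC] [D D0 HD]].
- by exists (`|c| + 1) => [|u _]; rewrite ?pevalC; have := normr_ge0 c => *; lra.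
- exists (`|s| + 1) => [|u su]; first by have := normr_ge0 s => *; lra.
  by rewrite pevalXU; have := su i; have := ler_norm s => *; lra.
- exists (C + D) => [|u su]; first by rewrite addr_gt0.
  by rewrite pevalD (le_trans (ler_normD _ _)) // lerD ?HC ?HD.
- exists (C * D) => [|u su]; first by rewrite mulr_gt0.
  by rewrite pevalM normrM ler_pM ?HC ?HD.
Qed.

Lemma poly_pos_near p x : 0 < peval p x ->
  exists2 r : R, 0 < r & forall u, near x r u -> 0 < peval p u.
Proof.
move=> p0; have [r r0 Hr] := poly_cont p x p0.
by exists r => // u /Hr; rewrite ltr_norml => /andP[*]; lra.
Qed.

(** The directional derivative, kept as a polynomial so that it can be iterated. *)
Definition dir v p : {mpoly R[n]} := \sum_i v 0 i *: p^`M(i).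

Lemma dirD v p q : dir v (p + q) = dir v p + dir v q.
Proof.
by rewrite -big_split; apply: eq_bigr => i _; rewrite mderivD scalerDr.
Qed.

Lemma dirC v c : dir v c%:MP = 0.
Proof. by rewrite /dir big1 // => i _; rewrite mderivC scaler0. Qed.

Lemma dir1 v : dir v 1 = 0.
Proof. by rewrite -mpolyC1 dirC. Qed.

Lemma dirXU v i : dir v 'X_i = (v 0 i)%:MP.
Proof.
rewrite /dir (bigD1 i) //= mderivX mnm1E eqxx big1 => [|j ji]; last first.
  by rewrite mderivX mnm1E eq_sym (negPf ji) scale0r scaler0.
have -> : (U_(i) - U_(i))%MM = 0%MM :> 'X_{1..n} by apply/mnmP => j; rewrite mnmBE mnm0E subnn.
by rewrite mpolyX0 addr0 scale1r alg_mpolyC.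
Qed.

Lemma dirM v p q : dir v (p * q) = dir v p * q + p * dir v q.
Proof.
rewrite /dir mulr_suml mulr_sumr -big_split; apply: eq_bigr => i _.
by rewrite mderivM scalerDr scalerAl scalerAr.
Qed.

Lemma dirZ v c p : dir v (c *: p) = c *: dir v p.
Proof.
rewrite scaler_sumr; apply: eq_bigr => i _.
by rewrite mderivZ !scalerA mulrC.
Qed.

Lemma dirN v p : dir v (- p) = - dir v p.
Proof. by rewrite -scaleN1r dirZ scaleN1r. Qed.

Lemma dirB v p q : dir v (p - q) = dir v p - dir v q.
Proof. by rewrite dirD dirN. Qed.

Lemma dir_sum (I : Type) (s : seq I) (F : I -> {mpoly R[n]}) v :
  dir v (\sum_(i <- s) F i) = \sum_(i <- s) dir v (F i).
Proof.
elim/big_rec2: _ => [|i y1 y2 _ <-]; last by rewrite dirD.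
by rewrite -mpolyC0 dirC.
Qed.

Lemma dirB_sum (I : Type) (s : seq I) (F : I -> {mpoly R[n]}) p v :
  dir v (p - \sum_(i <- s) F i) = dir v p - \sum_(i <- s) dir v (F i).
Proof. by rewrite dirB dir_sum. Qed.

Lemma peval_dir v p u : peval (dir v p) u = dot v (gradient p u).
Proof. by rewrite peval_sum; apply: eq_bigr => i _; rewrite !mxE pevalZ. Qed.

Lemma peval_dirZ c v p u : peval (dir (c *: v) p) u = c * peval (dir v p) u.
Proof. by rewrite !peval_dir dotZl. Qed.

Lemma peval_dir2 v p u : peval (dir v (dir v p)) u =
  qform (fun a b => peval p^`M(a)^`M(b) u) v.
Proof.
rewrite {2}/dir dir_sum peval_sum; apply: eq_bigr => a _.
rewrite dirZ /dir pevalZ peval_sum mulr_sumr; apply: eq_bigr => b _.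
by rewrite pevalZ mulrA.
Qed.

Lemma hessian_dir2 v p u :
  (v *m hessian p u *m v^T) 0 0 = peval (dir v (dir v p)) u.
Proof.
rewrite peval_dir2 /qform exchange_big mxE; apply: eq_bigr => b _.
rewrite !mxE mulr_suml; apply: eq_bigr => a _; rewrite !mxE; ring.
Qed.

Lemma peval_dir_sqrM v q p u : peval (dir v (q ^+ 2 * p)) u =
  2 * peval q u * peval (dir v q) u * peval p u + peval q u ^+ 2 * peval (dir v p) u.
Proof. by rewrite expr2 !dirM !(pevalM, pevalD); ring. Qed.

Lemma peval_dir2_sqrM v q p u : peval (dir v (dir v (q ^+ 2 * p))) u =
  (2 * peval (dir v q) u ^+ 2 + 2 * peval q u * peval (dir v (dir v q)) u) * peval p u +
  4 * peval q u * peval (dir v q) u * peval (dir v p) u +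
  peval q u ^+ 2 * peval (dir v (dir v p)) u.
Proof. by rewrite expr2 !(dirM, dirD) !(pevalM, pevalD); ring. Qed.

(** The remainder is exact, with polynomial coefficients in [u]. For a product, with [ell] the
    first-order part of [p] at [z], one expands [p q] as [(p - ell) q + ell q]; the product of the
    two differentials supplies the rank-one term. *)
Lemma Taylor2 z p : exists T : 'I_n -> 'I_n -> {mpoly R[n]},
  (forall u, peval p u = peval p z + peval (dir (u - z) p) z +
     qform (fun a b => peval (T a b) u) (u - z)) /\
  (forall v, qform (fun a b => peval (T a b) z) v = peval (dir v (dir v p)) z / 2).
Proof.
have Q0 u v : qform (fun a b : 'I_n => peval 0 u) v = 0.
  by rewrite /qform big1 // => a _; rewrite big1 // => b _; rewrite peval0 mulr0.
elim/mpoly_ring_ind: p => [c|i|p q [T [HT hT]] [T' [HT' hT']]|p q [T [HT hT]] [T' [HT' hT']]].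
- exists (fun _ _ => 0); split=> [u|v]; first by rewrite Q0 dirC peval0 !pevalC !addr0.
  by rewrite Q0 dirC -mpolyC0 dirC peval0 mul0r.
- exists (fun _ _ => 0); split=> [u|v]; first by rewrite Q0 dirXU !pevalE !mxE; ring.
  by rewrite Q0 dirXU dirC peval0 mul0r.
- exists (fun a b => T a b + T' a b); split=> [u|v].
    under eq_qform do rewrite pevalD.
    by rewrite qformD dirD !pevalD HT HT'; ring.
  under eq_qform do rewrite pevalD.
  by rewrite qformD hT hT' !dirD pevalD mulrDl.
pose ell := (peval p z)%:MP + \sum_i (peval p^`M(i) z) *: ('X_i - (z 0 i)%:MP).
have ellE u : peval ell u = peval p z + peval (dir (u - z) p) z.
  rewrite pevalD pevalC peval_sum peval_sum; congr (_ + _); apply: eq_bigr => i _.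
  by rewrite !pevalE !mxE mulrC.
pose G (p : {mpoly R[n]}) := gradient p z.
exists (fun a b => T a b * q + ell * T' a b + (G p 0 a * G q 0 b)%:MP).
have QE u v : qform (fun a b => peval (T a b * q + ell * T' a b + (G p 0 a * G q 0 b)%:MP) u) v =
   peval q u * qform (fun a b => peval (T a b) u) v +
   peval ell u * qform (fun a b => peval (T' a b) u) v +
   peval (dir v p) z * peval (dir v q) z.
  rewrite -!qform_scale -!qformD /qform !peval_dir /dot mulr_suml -big_split.
  apply: eq_bigr => a _; rewrite mulr_sumr -big_split; apply: eq_bigr => b _ /=.
  by rewrite !pevalE; ring.
split=> [u|v]; rewrite QE ellE ?subrr.
  by rewrite pevalM dirM [in RHS]pevalM !pevalD !pevalM (HT u) (HT' u); ring.
have -> : peval (dir 0 p) z = 0 by rewrite peval_dir dot0l.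
by rewrite hT hT' !dirM dirD !dirM !pevalE; field.
Qed.

Lemma first_order_pos p z v : 0 < peval (dir v p) z ->
  exists2 r : R, 0 < r & forall t, 0 < t < r -> peval p z < peval p (z + t *: v).
Proof.
move=> D0; have [T [HT _]] := Taylor2 z p.
pose D := peval (dir v p) z.
pose s : R := \sum_i (`|z 0 i| + `|v 0 i|).
have [C C0 HC] : exists2 C : R, 0 < C & forall u, box s u ->
    `|qform (fun a b => peval (T a b) u) v| <= C.
  pose q := \sum_a \sum_b v 0 a * v 0 b *: T a b.
  have [C C0 HC] := poly_bounded q s; exists C => // u /HC.
  suff -> : peval q u = qform (fun a b => peval (T a b) u) v by [].
  rewrite peval_sum; apply: eq_bigr => a _; rewrite peval_sum.
  by apply: eq_bigr => b _; rewrite pevalZ.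
exists (Num.min 1 (D / C)) => [|t /andP[t0]]; first by rewrite lt_min ltr01 divr_gt0.
rewrite lt_min => /andP[t1 tD]; rewrite (HT (z + _)) (addrC z) addrK peval_dirZ qformZ -/D.
set Q := qform _ _.
have : `|Q| <= C.
  apply: HC => i; rewrite !mxE.
  apply: (@le_trans _ _ (`|z 0 i| + `|v 0 i|)).
    rewrite (le_trans (ler_normD _ _)) // [X in X <= _]addrC lerD2l normrM (gtr0_norm t0).
    by rewrite ler_piMl // ltW.
  by rewrite /s (bigD1 i) //= lerDl sumr_ge0 // => j _; rewrite addr_ge0.
rewrite ler_norml => /andP[hQ _].
move: tD; rewrite ltr_pdivlMr // => tD.
have : 0 < t * (D + t * Q).
  by rewrite mulr_gt0 //; nra.
by rewrite mulrDr mulrA -expr2 => *; lra.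
Qed.

(** By [first_order_pos] for [q] and [- q], the derivatives of a vanishing function vanish. Their
    values at 0 are the coefficients times products of factorials, which are nonzero in
    characteristic 0. *)
Lemma peval_eq0 p : (forall u, peval p u = 0) -> p = 0.
Proof.
have deriv0 q i : (forall u, peval q u = 0) -> forall u, peval q^`M(i) u = 0.
  move=> q0 u; have dirE : peval (dir (delta_mx 0 i) q) u = peval q^`M(i) u.
    rewrite peval_dir /dot (bigD1 i) //= !mxE !eqxx mul1r big1 ?addr0 // => j ji.
    by rewrite !mxE eqxx (negPf ji) mul0r.
  have half (q' : {mpoly R[n]}) : (forall u, peval q' u = 0) -> ~ 0 < peval (dir (delta_mx 0 i) q') u.
    move=> q'0 /first_order_pos [r r0 /(_ (r / 2))]; rewrite !q'0 ltxx => F.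
    by suff: false by []; apply: F; lra.
  rewrite -dirE; case: (ltgtP (peval (dir (delta_mx 0 i) q) u) 0) => // Dq.
    case: (half (- q)) => [w|]; first by rewrite pevalN q0 oppr0.
    by rewrite dirN pevalN oppr_gt0.
  by case: (half q).
have derivm0 m : forall q, (forall u, peval q u = 0) -> forall u, peval q^`M[m] u = 0.
  move=> q q0; rewrite mderivm_foldr.
  by elim: (flatten _) q q0 => //= i s IH q q0; apply: deriv0; apply: IH.
move=> p0; apply/mpolyP => m; rewrite mcoeff0.
have := derivm0 m p p0 0.
have coef0 (q : {mpoly R[n]}) : peval q 0 = q@_0.
  elim/mpoly_ring_ind: q => [c|i|q r IHq IHr|q r IHq IHr].
  - by rewrite pevalC mcoeffC eqxx mulr1.
  - by rewrite pevalXU mxE mcoeffX mnm1_eq0.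
  - by rewrite pevalD mcoeffD IHq IHr.
  - by rewrite pevalM rmorphM IHq IHr.
rewrite coef0 mcoeff_mderivm addm0 => /eqP; rewrite mulrn_eq0 => /orP[|/eqP //].
rewrite -leqn0 leqNgt prodn_cond_gt0 // => i _.
by rewrite ffactnn fact_gt0.
Qed.

End Polynomials.

(** * Definite quadratic forms *)

Section Definiteness.
Variable R : realType.

Lemma near_forall n (I : finType) (x : 'rV[R]_n) (P : I -> 'rV[R]_n -> Prop) :
  (forall i, exists2 r : R, 0 < r & forall u, near x r u -> P i u) ->
  exists2 r : R, 0 < r & forall u, near x r u -> forall i, P i u.
Proof.
move=> H; suff [r r0 Hr] : exists2 r : R, 0 < r & forall u, near x r u ->
    forall i, i \in enum I -> P i u.
  by exists r => // u /Hr Pu i; apply: Pu; rewrite mem_enum.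
elim: (enum I) => [|i s [r r0 Hr]]; first by exists 1.
have [r' r'0 Hr'] := H i; exists (Num.min r r'); first by rewrite lt_min r0.
move=> u xu j; rewrite inE => /orP[/eqP ->|].
  by apply: Hr'; apply: near_le xu; rewrite ge_min lexx orbT.
by apply: Hr; apply: near_le xu; rewrite ge_min lexx.
Qed.

Lemma closed_sphere n : closed_set (fun u : 'rV[R]_n => dot u u = 1).
Proof.
move=> x /eqP; rewrite -subr_eq0 => x1; have x0 : 0 < `|dot x x - 1| by rewrite normr_gt0.
have [r r0 Hr] := poly_cont (sqnorm R n) x x0.
exists r => // u /Hr; rewrite !peval_sqnorm => + u1.
by rewrite u1 distrC ltxx.
Qed.

Lemma sphere_box n (u : 'rV[R]_n) : dot u u = 1 -> box 1 u.
Proof.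
move=> u1 i; rewrite -(@ler_pXn2r _ 2) ?nnegrE // real_normK ?num_real //.
by rewrite expr1n -u1 sqr_coord_le.
Qed.

Lemma normalize n (v : 'rV[R]_n) : v != 0 ->
  exists2 a : R, 0 < a & dot (a *: v) (a *: v) = 1 /\ a ^+ 2 * dot v v = 1.
Proof.
rewrite -dot_gt0 => v0; exists (Num.sqrt (dot v v))^-1; first by rewrite invr_gt0 sqrtr_gt0.
rewrite !dotE mulrA -expr2 exprVn sqr_sqrtr ?(ltW v0) // mulVf //.
by rewrite gt_eqF.
Qed.

Lemma qform_cont n k (A : 'I_k -> 'I_k -> {mpoly R[n]}) x (e : R) : 0 < e ->
  exists2 r : R, 0 < r & forall u, near x r u -> forall v,
    `|qform (fun a b => peval (A a b) u) v - qform (fun a b => peval (A a b) x) v| <=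
    e * dot v v.
Proof.
(* The error is shared by [k * k] entries; the successor keeps the divisor positive when [k = 0]. *)
move=> e0; pose e' := e / (k * k).+1%:R.
have K0 : (0 : R) < (k * k).+1%:R by rewrite ltr0n.
have e'0 : 0 < e' by rewrite divr_gt0.
have [r r0 Hr] := @near_forall n ('I_k * 'I_k)%type x _
  (fun i => poly_cont (A i.1 i.2) x e'0).
exists r => // u /Hr hu v.
pose D a b := peval (A a b) u - peval (A a b) x.
have -> : qform (fun a b => peval (A a b) u) v - qform (fun a b => peval (A a b) x) v =
    qform D v.
  rewrite -[X in _ - X]mul1r -mulNr -qform_scale -qformD.
  by apply: eq_qform => a b; rewrite mulN1r.
apply: le_trans (qform_bound _ _) _; rewrite ler_wpM2r ?dot_ge0 //.
apply: (@le_trans _ _ (\sum_(a < k) \sum_(b < k) e')).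
  by apply: ler_sum => a _; apply: ler_sum => b _; apply: ltW (hu (a, b)).
rewrite !sumr_const !card_ord -mulrnA -[e' *+ _]mulr_natl /e' mulrCA.
by rewrite ler_piMr ?(ltW e0) // ler_pdivrMr // mul1r ler_nat.
Qed.

Lemma qform_poly k (C : 'I_k -> 'I_k -> R) :
  exists p : {mpoly R[k]}, forall v, peval p v = qform C v.
Proof.
exists (\sum_a \sum_b C a b *: ('X_a * 'X_b)) => v.
rewrite peval_sum; apply: eq_bigr => a _; rewrite peval_sum; apply: eq_bigr => b _.
by rewrite !pevalE mulrC.
Qed.

(** Near a unit vector in the kernel of [B] the form [A] is positive by continuity; near any other
    unit vector [B] is bounded below and a large [C] wins. The sphere being compact, finitely many
    constants suffice. *)
Lemma Finsler_const k (A B : 'I_k -> 'I_k -> R) :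
  (forall v, 0 <= qform B v) ->
  (forall v, v != 0 -> qform B v = 0 -> 0 < qform A v) ->
  exists C mu, [/\ 0 <= C, 0 < mu & forall v, mu * dot v v <= qform A v + C * qform B v].
Proof.
move=> B0 A0.
(* All larger [C'] are included so that the constants of two sets can be replaced by their
   maximum. *)
pose P (X : 'rV[R]_k -> Prop) := exists C mu, [/\ 0 <= C, 0 < mu & forall C' v, C <= C' ->
  X v -> mu <= qform A v + C' * qform B v].
have [a aE] := qform_poly A; have [b bE] := qform_poly B.
have [||||C [mu [C0 mu0 H]]] :=
    @compact_ind R k (fun u => dot u u = 1) 1 P (@sphere_box k) (@closed_sphere k).
- move=> X Y XY [C [mu [? ? H]]]; exists C, mu; split=> // C' v ? /XY; exact: H.
- move=> X Y [C [mu [? ? H]]] [C1 [mu1 [? ? H1]]].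
  exists (Num.max C C1), (Num.min mu mu1); split; rewrite ?lt_min ?le_max; first lra.
    by apply/andP.
  move=> C' v; rewrite ge_max ge_min => /andP[? ?] [/H|/H1] -> //.
  by rewrite orbT.
- by exists 0, 1; split.
- move=> x x1; have x0 : x != 0.
    by apply: contra_eq_neq x1 => ->; rewrite dot0l eq_sym oner_neq0.
  have [Bx|Bx] := eqVneq (qform B x) 0.
    have Ax := A0 x x0 Bx.
    have [r r0 Hr] := @poly_cont R k a x (qform A x / 2) ltac:(lra).
    exists r => //; exists 0, (qform A x / 2); split; [lra|lra|] => C' v C'0 [v1 /Hr].
    rewrite !aE ltr_norml => /andP[? ?].
    have : 0 <= C' * qform B v by rewrite mulr_ge0.
    by move=> ?; lra.
  have {}Bx : 0 < qform B x by rewrite lt0r Bx B0.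
  have [r r0 Hr] := @poly_cont R k a x 1 ltac:(lra).
  have [s s0 Hs] := @poly_cont R k b x (qform B x / 2) ltac:(lra).
  exists (Num.min r s); first by rewrite lt_min r0.
  have Ax := normr_ge0 (qform A x).
  have q0 : 0 <= (`|qform A x| + 2) / (qform B x / 2).
    by rewrite divr_ge0 //; lra.
  exists ((`|qform A x| + 2) / (qform B x / 2)), 1; split=> // C' v HC [v1 xv].
  have := Hr v (near_le _ xv); have := Hs v (near_le _ xv).
  rewrite !ge_min !lexx orbT !aE !bE !ltr_norml.
  move=> /(_ isT)/andP[h1 h2] /(_ isT)/andP[h3 h4].
  have h5 : (`|qform A x| + 2) <= C' * (qform B x / 2) by rewrite -ler_pdivrMr //; lra.
  have h6 : C' * (qform B x / 2) <= C' * qform B v.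
    by rewrite ler_wpM2l //; [exact: le_trans q0 HC | lra].
  have h7 : - `|qform A x| <= qform A x by rewrite lerNl ler_normr lexx orbT.
  by lra.
exists C, mu; split=> // v; have [->|v0] := eqVneq v 0.
  by rewrite dot0l mulr0 -(scale0r 0) !qformZ; lra.
have [t t0 [t1 t2]] := normalize v0.
have := H C _ (lexx _) t1; rewrite !qformZ mulrCA -mulrDr => h.
have t20 : 0 < t ^+ 2 by rewrite exprn_gt0.
by rewrite -(ler_pM2l t20) mulrCA t2 mulr1.
Qed.

(** At each point of the box the constant case gives [C] and [mu]; half of [mu] absorbs the
    variation of the matrix nearby, and semidefiniteness of [B] allows [C] to grow. Compactness
    makes both uniform. *)
Lemma Finsler n k (A B : 'I_k -> 'I_k -> {mpoly R[n]}) (s : R) :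
  (forall x v, 0 <= qform (fun a b => peval (B a b) x) v) ->
  (forall x v, box s x -> v != 0 -> qform (fun a b => peval (B a b) x) v = 0 ->
     0 < qform (fun a b => peval (A a b) x) v) ->
  exists C mu, [/\ 0 <= C, 0 < mu & forall x v, box s x ->
    mu * dot v v <= qform (fun a b => peval (A a b + C *: B a b) x) v].
Proof.
move=> B0 A0.
have ABE C x v : qform (fun a b => peval (A a b + C *: B a b) x) v =
    qform (fun a b => peval (A a b) x) v + C * qform (fun a b => peval (B a b) x) v.
  by rewrite -qform_scale -qformD; apply: eq_qform => a b; rewrite !pevalE.
pose P (X : 'rV[R]_n -> Prop) := exists C mu, [/\ 0 <= C, 0 < mu & forall C' x v, C <= C' ->
  X x -> mu * dot v v <= qform (fun a b => peval (A a b + C' *: B a b) x) v].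
have closed_box : closed_set (@box R n s).
  move=> x /boolp.existsNP[i /negP]; rewrite -ltNge => xi.
  exists (`|x 0 i| - s) => [|u /(_ i) xu /(_ i) ui]; first lra.
  have := ler_normB (u 0 i) (u 0 i - x 0 i); rewrite opprB addrC subrK.
  by move=> ?; lra.
have [||||C [mu [C0 mu0 H]]] :=
    @compact_ind R n (box s) s P (fun u => id) closed_box.
- move=> X Y XY [C [mu [? ? H]]]; exists C, mu; split=> // C' x v ? /XY; exact: H.
- move=> X Y [C [mu [? ? H]]] [C1 [mu1 [? ? H1]]].
  exists (Num.max C C1), (Num.min mu mu1); split; rewrite ?lt_min ?le_max; first lra.
    by apply/andP.
  move=> C' x v; rewrite ge_max => /andP[/H ha /H1 hb].
  have := dot_ge0 v => ?.
  move=> [/ha|/hb] hx; apply: le_trans (hx v); rewrite ler_wpM2r // ge_min lexx //.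
  by rewrite orbT.
- by exists 0, 1; split.
- move=> x bx; have [C [mu [C0 mu0 H]]] := Finsler_const (B0 x) (fun v => A0 x v bx).
  have mu2 : 0 < mu / 2 by rewrite divr_gt0.
  have [r r0 Hr] := qform_cont (fun a b => A a b + C *: B a b) x mu2.
  exists r => //; exists C, (mu / 2); split=> //.
  move=> C' u v CC' [_ /Hr/(_ v) Dbound].
  have h1 := H v; rewrite -ABE in h1.
  have h2 : 0 <= (C' - C) * qform (fun a b => peval (B a b) u) v.
    by rewrite mulr_ge0 ?B0 // subr_ge0.
  move: Dbound; rewrite !ABE ler_norml => /andP[h3 _].
  by rewrite ABE in h1; lra.
by exists C, mu; split=> // x v; apply: H.
Qed.

(** Cholesky decomposition: completing the square in the first variable leaves the Schur complement
    [D'], again positive definite and of smaller size. *)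
Lemma posdef_sum_of_squares k (C : 'I_k -> 'I_k -> R) :
  (forall v, v != 0 -> 0 < qform C v) ->
  exists s : seq 'rV[R]_k, forall v, qform C v = \sum_(w <- s) dot w v ^+ 2.
Proof.
elim: k C => [|k IH] C0 pos0.
  by exists [::] => v; rewrite big_nil /qform big_ord0.
(* Symmetry is not assumed, and the form only sees the symmetric part. *)
pose C a b := (C0 a b + C0 b a) / 2.
have CE v : qform C v = qform C0 v.
  have -> : qform C v = qform (fun a b => 2^-1 * (C0 a b + C0 b a)) v.
    by apply: eq_qform => a b; rewrite /C mulrC.
  rewrite qform_scale qformD.
  have -> : qform (fun a b => C0 b a) v = qform C0 v.
    rewrite /qform exchange_big; apply: eq_bigr => a _; apply: eq_bigr => b _.
    by rewrite [v 0 b * _]mulrC.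
  by field.
have pos v : v != 0 -> 0 < qform C v by rewrite CE; apply: pos0.
have Csym a b : C a b = C b a by rewrite /C addrC.
have c0 : 0 < C ord0 ord0.
  have := pos (delta_mx 0 ord0).
  have -> : qform C (delta_mx 0 ord0) = C ord0 ord0.
    rewrite /qform (bigD1 ord0) //= [X in _ + X]big1 ?addr0 => [|a a0]; last first.
      by rewrite big1 // => b _; rewrite !mxE (negPf a0) !mul0r.
    rewrite (bigD1 ord0) //= big1 ?addr0 => [|a a0]; last first.
      by rewrite !mxE (negPf a0) mulr0 mul0r.
    by rewrite !mxE !eqxx !mul1r.
  apply; apply/eqP => /rowP/(_ ord0)/eqP; rewrite !mxE !eqxx.
  by rewrite oner_eq0.
pose t := Num.sqrt (C ord0 ord0).
have t0 : 0 < t by rewrite sqrtr_gt0.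
have tt : t * t = C ord0 ord0 by rewrite -expr2 sqr_sqrtr // ltW.
pose w : 'rV[R]_k.+1 := \row_b (C ord0 b / t).
pose D a b := C a b - w 0 a * w 0 b.
have D0 b : D ord0 b = 0.
  by rewrite /D !mxE -tt; field; rewrite gt_eqF.
have D0' a : D a ord0 = 0 by rewrite -(D0 a) /D Csym [w 0 a * _]mulrC.
pose D' (a b : 'I_k) := D (lift ord0 a) (lift ord0 b).
pose tl (v : 'rV[R]_k.+1) : 'rV[R]_k := \row_i v 0 (lift ord0 i).
have DE v : qform D v = qform D' (tl v).
  rewrite /qform big_ord_recl big1 ?add0r => [|b _]; last by rewrite D0 mulr0.
  apply: eq_bigr => a _; rewrite big_ord_recl D0' mulr0 add0r.
  by apply: eq_bigr => b _; rewrite !mxE.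
have CDE v : qform C v = dot w v ^+ 2 + qform D' (tl v).
  rewrite -DE -qform_rank1 -qformD; apply: eq_qform => a b.
  by rewrite /D addrC subrK.
have [v v0|s Hs] := IH D'.
  (* With first coordinate [c] the completed square vanishes, so the form at [v'] is the Schur
     complement at [v]. *)
  pose c := - (\sum_i w 0 (lift ord0 i) * v 0 i) / w 0 ord0.
  have w0 : w 0 ord0 != 0 by rewrite mxE mulf_neq0 ?invr_eq0 ?gt_eqF.
  pose v' : 'rV[R]_k.+1 := \row_i (if unlift ord0 i is Some j then v 0 j else c).
  have tlv : tl v' = v by apply/rowP => i; rewrite !mxE liftK.
  have v'0 : v' != 0.
    apply: contraNneq v0 => v'0; rewrite -tlv v'0.
    by apply/eqP/rowP => i; rewrite !mxE.
  have := pos _ v'0; rewrite CDE tlv; suff -> : dot w v' = 0 by rewrite expr0n add0r.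
  rewrite /dot big_ord_recl [v' 0 ord0]mxE unlift_none.
  have -> : \sum_(i < k) w 0 (lift ord0 i) * v' 0 (lift ord0 i) =
     \sum_i w 0 (lift ord0 i) * v 0 i.
    by apply: eq_bigr => i _; rewrite [v' 0 _]mxE liftK.
  by rewrite /c mulrC divfK // addNr.
pose ext (v : 'rV[R]_k) : 'rV[R]_k.+1 :=
  \row_i (if unlift ord0 i is Some j then v 0 j else 0).
exists (w :: map ext s) => v; rewrite -CE CDE big_cons big_map; congr (_ + _).
rewrite Hs; apply: eq_bigr => u _; congr (_ ^+ 2).
rewrite [RHS]/dot big_ord_recl mxE unlift_none mul0r add0r.
by apply: eq_bigr => i _; rewrite !mxE liftK.
Qed.

End Definiteness.

(** * Sums of squares on the sphere *)

Section Words.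
Variables (R : realType) (K : finType).
Implicit Types (y : K -> R).

(* Words of length [D] over [K] index the expansion of the D-th power of
   [\sum_k y k]; sampling letters at distinct positions preserves the law. *)
Lemma sum_words_sample y D M (i : {ffun 'I_D -> 'I_M}) (c : {ffun 'I_D -> K} -> R) :
  \sum_k y k = 1 -> injective i ->
  \sum_(w : {ffun 'I_M -> K}) (\prod_a y (w a)) * c [ffun j => w (i j)] =
  \sum_(w : {ffun 'I_D -> K}) (\prod_j y (w j)) * c w.
Proof.
move=> y1 inj_i.
rewrite (partition_big (fun w : {ffun 'I_M -> K} => [ffun j => w (i j)] : {ffun 'I_D -> K}) xpredT) //=.
apply: eq_bigr => w _.
rewrite (eq_bigr (fun v : {ffun 'I_M -> K} => (\prod_a y (v a)) * c w)); last first.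
  by move=> v /eqP ->.
rewrite -mulr_suml; congr (_ * _).
pose Q a k := [forall j, (i j == a) ==> (w j == k)].
rewrite (eq_bigl (fun v => v \in family Q)) => [|v]; last first.
  apply/eqP/familyP => [wE a|vQ].
    by apply/forallP => j; apply/implyP => /eqP <-; rewrite -wE ffunE.
  apply/ffunP => j; rewrite ffunE.
  by have /forallP/(_ j)/implyP/(_ (eqxx _))/eqP -> := vQ (i j).
rewrite -(bigA_distr_big_dep Q (fun a k => y k)) /=.
rewrite (bigID (fun a => a \in i @: 'I_D)) /= [X in _ * X]big1 ?mulr1 => [|a ai]; last first.
  rewrite -y1; apply: eq_bigl => k; apply/forallP => j; apply/implyP => /eqP ij.
  by rewrite -ij imset_f in ai.
rewrite big_imset /=; last by move=> a b _ _; apply: inj_i.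
apply: eq_big => [j|j _]; first by rewrite inE.
rewrite (big_pred1 (w j)) // => k; apply/forallP/eqP => [/(_ j)|-> j'].
  by rewrite eqxx => /eqP.
by apply/implyP => /eqP/inj_i ->.
Qed.

(** Among the [M ^ D] samples, at most a fraction [D ^ 2 / M] repeats a position; stated without
    division or subtraction. *)
Lemma expn_sub_ffact M D : (D <= M)%N ->
  (M ^ D.+1 <= M * M ^_ D + D ^ 2 * M ^ D)%N.
Proof.
elim: D => [|D IH] DM; first by rewrite ffactn0; lia.
have {}IH := IH (ltnW DM).
have h := leq_mul (leqnn M) IH.
have le_f : (M ^_ D <= M ^ D)%N.
  elim: D {DM IH h} => [|D IH]; first by rewrite ffactn0.
  by rewrite ffactnSr expnSr leq_mul // leq_subr.
rewrite ffactnSr; move: IH h le_f; rewrite !expnS.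
set A := (M ^ D)%N; set B := (M ^_ D)%N => IH h le_f.
have E : (B * (M - D) + B * D = B * M)%N by rewrite -mulnDr subnK // ltnW.
have E2 : (M * (B * (M - D)) + M * (B * D) = M * (B * M))%N by rewrite -mulnDr E.
have h2 : (M * (B * D) <= M * (A * D))%N by rewrite leq_mul // leq_mul.
nia.
Qed.

(* Polya's theorem.  After multiplying by a power of [\sum_a y a = 1], the
   coefficient of a long word w is the average of [c] over the samples of w at
   distinct positions; without "distinct" this average is the value of the
   form at the letter frequencies of w, and few samples repeat a position. *)
Lemma Polya_posdef k D (c : {ffun 'I_D -> K} -> 'I_k -> 'I_k -> R) (mu : R) :
  0 < mu ->
  (forall y, (forall a, 0 <= y a) -> \sum_a y a = 1 -> forall v : 'rV[R]_k,
     mu * dot v v <= \sum_(w : {ffun 'I_D -> K}) (\prod_j y (w j)) * qform (c w) v) ->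
  exists M (C : {ffun 'I_M -> K} -> 'I_k -> 'I_k -> R),
    (forall w v, v != 0 -> 0 < qform (C w) v) /\
    forall y, \sum_a y a = 1 -> forall v : 'rV[R]_k,
      \sum_(w : {ffun 'I_D -> K}) (\prod_j y (w j)) * qform (c w) v =
      \sum_(w : {ffun 'I_M -> K}) (\prod_j y (w j)) * qform (C w) v.
Proof.
move=> mu0 H.
pose B := \sum_w \sum_a \sum_b `|c w a b|.
have B0 : 0 <= B by apply: sumr_ge0 => w _; apply: sumr_ge0 => a _; apply: sumr_ge0.
have cB w v : `|qform (c w) v| <= B * dot v v.
  apply: le_trans (qform_bound _ _) _; rewrite ler_wpM2r ?dot_ge0 //.
  rewrite /B (bigD1 w) //= lerDl; apply: sumr_ge0 => ? _.
  by apply: sumr_ge0 => ? _; apply: sumr_ge0.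
(* Samples with a repeated position make up a fraction at most [D ^ 2 / M], and each contributes at
   most [B * dot v v]. This [M] keeps their share below the margin [mu * dot v v]. *)
pose M := (D + Num.truncn (D%:R ^+ 2 * B / mu)).+1.
have DM : (D <= M)%N by rewrite /M -addnS leq_addr.
have M0 : (0 : R) < M%:R by rewrite ltr0n.
have MB : D%:R ^+ 2 * B < M%:R * mu.
  rewrite -ltr_pdivrMr //; apply: lt_le_trans (truncnS_gt _) _.
  by rewrite ler_nat /M ltnS leq_addl.
pose inj (i : {ffun 'I_D -> 'I_M}) := injectiveb i.
pose N := (M ^_ D)%N.
have cardN : #|[pred i | inj i]| = N.
  by have := card_inj_ffuns 'I_D 'I_M; rewrite !card_ord cardsE.
have N0 : (0 : R) < N%:R by rewrite ltr0n ffact_gt0.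
pose samp (w : {ffun 'I_M -> K}) (i : {ffun 'I_D -> 'I_M}) : {ffun 'I_D -> K} :=
  [ffun j => w (i j)].
pose C w a b : R := N%:R^-1 * \sum_(i | inj i) c (samp w i) a b.
have CE w v : qform (C w) v = N%:R^-1 * \sum_(i | inj i) qform (c (samp w i)) v.
  by rewrite qform_scale qform_sum.
exists M, C; split=> [w v v0|y y1 v]; last first.
  under [RHS]eq_bigr do rewrite CE mulrCA mulr_sumr.
  rewrite -mulr_sumr exchange_big /=.
  rewrite [X in _ = _ * X](eq_bigr (fun=> \sum_(w : {ffun 'I_D -> K}) (\prod_j y (w j)) * qform (c w) v)).
    by rewrite sumr_const cardN -[X in _ = _ * X]mulr_natl mulrA mulVf ?mul1r ?gt_eqF.
  by move=> i /injectiveP; apply: sum_words_sample.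
rewrite CE mulr_gt0 ?invr_gt0 //.
have v2 : 0 < dot v v by rewrite dot_gt0.
pose fr k : R := M%:R^-1 * \sum_(a < M) (w a == k)%:R.
have fr0 a : 0 <= fr a by rewrite mulr_ge0 ?invr_ge0 ?(ltW M0) //; apply: sumr_ge0 => *; apply: ler0n.
have fr1 : \sum_a fr a = 1.
  rewrite -mulr_sumr exchange_big /= (eq_bigr (fun=> 1)) => [|a _].
    by rewrite sumr_const card_ord mulVf ?gt_eqF.
  by rewrite (bigD1 (w a)) //= eqxx big1 ?addr0 // => b; rewrite eq_sym => /negPf ->.
have frE : \sum_(w' : {ffun 'I_D -> K}) (\prod_j fr (w' j)) * qform (c w') v =
    M%:R ^- D * \sum_i qform (c (samp w i)) v.
  have E (w' : {ffun 'I_D -> K}) : \prod_j fr (w' j) =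
      M%:R ^- D * \sum_(i : {ffun 'I_D -> 'I_M}) (samp w i == w')%:R.
    rewrite big_split /= prodr_const card_ord exprVn; congr (_ * _).
    rewrite bigA_distr_bigA; apply: eq_bigr => i _.
    have [<-|ne] := eqVneq (samp w i) w'.
      by rewrite big1 // => j _; rewrite ffunE eqxx.
    have [j jne] : exists j, w (i j) != w' j.
      apply/existsP; apply: contraNT ne; rewrite negb_exists => /forallP h.
      by apply/eqP/ffunP => j; rewrite ffunE; apply/eqP; have := h j; rewrite negbK.
    by rewrite (bigD1 j) //= (negPf jne) mul0r.
  under eq_bigr do rewrite E -mulrA mulr_suml.
  rewrite -mulr_sumr exchange_big /=; congr (_ * _); apply: eq_bigr => i _.
  rewrite (bigD1 (samp w i)) //= eqxx mul1r big1 ?addr0 // => w' ne.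
  by rewrite eq_sym (negPf ne) mul0r.
have := H fr fr0 fr1 v; rewrite frE [X in _ <= X]mulrC ler_pdivlMr ?exprn_gt0 //.
rewrite (bigID inj) /= => le_all.
have le_non : \sum_(i | ~~ inj i) qform (c (samp w i)) v <=
    (M%:R ^+ D - N%:R) * (B * dot v v).
  apply: le_trans (_ : _ <= \sum_(i | ~~ inj i) (B * dot v v)) _.
    by apply: ler_sum => i _; apply: le_trans (ler_norm _) (cB _ _).
  rewrite sumr_const -[X in X <= _]mulr_natl.
  suff -> : #|[pred i | ~~ inj i]|%:R = M%:R ^+ D - N%:R :> R by [].
  have := cardC [pred i | inj i]; rewrite cardN card_ffun !card_ord => h.
  rewrite -natrX -h natrD addrC addKr; congr (_%:R).
have le_N : M%:R * (M%:R ^+ D - N%:R) <= D%:R ^+ 2 * M%:R ^+ D :> R.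
  rewrite mulrBr lerBlDl -exprS -!natrX -!natrM -natrD ler_nat.
  exact: expn_sub_ffact.
have MD0 : 0 < M%:R ^+ D :> R by rewrite exprn_gt0.
suff h : (M%:R ^+ D - N%:R) * B < M%:R ^+ D * mu.
  by rewrite -(ltr_pM2r v2) in h; lra.
rewrite -(ltr_pM2l M0) mulrA.
apply: le_lt_trans (ler_wpM2r B0 le_N) _.
have : M%:R ^+ D * (D%:R ^+ 2 * B) < M%:R ^+ D * (M%:R * mu) by rewrite ltr_pM2l.
by move=> ?; lra.
Qed.

Lemma prod_nth_default (T : Type) (d : T) (G : T -> R) (s : seq T) D :
  G d = 1 -> (size s <= D)%N -> \prod_(j < D) G (nth d s j) = \prod_(x <- s) G x.
Proof.
move=> Gd; elim: s D => [|x s IH] [|D] // sD.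
- by rewrite big_ord0 big_nil.
- by rewrite big_nil big1 // => j _; rewrite nth_nil.
- by rewrite big_ord_recl big_cons -(IH D).
Qed.

(** Homogenization on the simplex: each monomial, a product of linear forms in [y], is padded with
    factors [\sum_k y k = 1] to the common length [D] and then expanded. *)
Lemma poly_words n (l : 'I_n -> K -> R) (p : {mpoly R[n]}) :
  exists D0, forall D, (D0 <= D)%N -> exists c : {ffun 'I_D -> K} -> R,
    forall y, \sum_k y k = 1 ->
    peval p (\row_i \sum_k y k * l i k) = \sum_(w : {ffun 'I_D -> K}) (\prod_j y (w j)) * c w.
Proof.
have [L HL] : exists L : seq (R * seq 'I_n), forall u,
    peval p u = \sum_(x <- L) x.1 * \prod_(i <- x.2) u 0 i.
  elim/mpoly_ring_ind: p => [c|i|p q [L HL] [L' HL']|p q [L HL] [L' HL']].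
  - by exists [:: (c, [::])] => u; rewrite big_seq1 big_nil mulr1 pevalC.
  - by exists [:: (1, [:: i])] => u; rewrite !big_seq1 mul1r pevalXU.
  - by exists (L ++ L') => u; rewrite big_cat pevalD HL HL'.
  - exists [seq (x.1 * x'.1, x.2 ++ x'.2) | x <- L, x' <- L'] => u.
    rewrite pevalM HL HL' big_allpairs_dep mulr_suml; apply: eq_bigr => x _.
    rewrite mulr_sumr; apply: eq_bigr => x' _; rewrite big_cat /=; ring.
exists (\max_(x <- L) size x.2) => D LD.
(* Positions past the end of the monomial read the default [fun=> 1], whose linear form is
   [\sum_k y k]. *)
pose fac (s : seq 'I_n) (j : 'I_D) := nth (fun=> 1) [seq l i | i <- s] j.
exists (fun w => \sum_(x <- L) x.1 * \prod_j fac x.2 j (w j)) => y y1.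
rewrite HL; under [RHS]eq_bigr do rewrite mulr_sumr.
rewrite exchange_big /=; rewrite [LHS]big_seq [RHS]big_seq; apply: eq_bigr => x xL.
under [RHS]eq_bigr do rewrite mulrCA -big_split /=.
rewrite -mulr_sumr -(bigA_distr_bigA (fun j k => y k * fac x.2 j k)); congr (_ * _).
rewrite (prod_nth_default (G := fun f => \sum_k y k * f k)) ?size_map.
- by rewrite big_map; apply: eq_bigr => i _; rewrite mxE.
- by under eq_bigr do rewrite mulr1.
- by apply: leq_trans LD; apply: leq_bigmax_seq.
Qed.

End Words.

(** * Sums of squares modulo the sphere and the matrix Positivstellensatz *)

Section SphereSOS.
Variables (R : realType) (n : nat).
Implicit Types (F G : 'rV[R]_n -> R) (u : 'rV[R]_n).

(** A property of functions rather than polynomials: identities are needed on the sphere only, and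
    no representative modulo its equation has to be chosen. *)
Definition sphere_sos F := exists s : seq {mpoly R[n]},
  forall u, dot u u = 1 -> F u = \sum_(q <- s) peval q u ^+ 2.

Lemma sphere_sos_eq F G : (forall u, dot u u = 1 -> F u = G u) ->
  sphere_sos G -> sphere_sos F.
Proof. by move=> FG [s Hs]; exists s => u u1; rewrite FG // Hs. Qed.

Lemma sphere_sos_sqr p : sphere_sos (fun u => peval p u ^+ 2).
Proof. by exists [:: p] => u _; rewrite big_seq1. Qed.

Lemma sphere_sos_const c : 0 <= c -> sphere_sos (fun=> c).
Proof.
move=> c0; exists [:: (Num.sqrt c)%:MP] => u _.
by rewrite big_seq1 pevalC sqr_sqrtr.
Qed.

Lemma sphere_sosD F G : sphere_sos F -> sphere_sos G -> sphere_sos (fun u => F u + G u).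
Proof.
move=> [s Hs] [t Ht]; exists (s ++ t) => u u1.
by rewrite big_cat Hs // Ht.
Qed.

Lemma sphere_sosM F G : sphere_sos F -> sphere_sos G -> sphere_sos (fun u => F u * G u).
Proof.
move=> [s Hs] [t Ht]; exists [seq p * q | p <- s, q <- t] => u u1.
rewrite Hs // Ht // big_allpairs_dep mulr_suml; apply: eq_bigr => p _.
by rewrite mulr_sumr; apply: eq_bigr => q _; rewrite pevalM exprMn.
Qed.

Lemma sphere_sos_sum (I : Type) (s : seq I) (F : I -> 'rV[R]_n -> R) :
  (forall i, sphere_sos (F i)) -> sphere_sos (fun u => \sum_(i <- s) F i u).
Proof.
move=> HF; elim: s => [|i s IH].
  by apply: sphere_sos_eq (sphere_sos_const (lexx 0)) => u _; rewrite big_nil.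
by apply: sphere_sos_eq (sphere_sosD (HF i) IH) => u _; rewrite big_cons.
Qed.

Lemma sphere_sos_prod (I : Type) (s : seq I) (F : I -> 'rV[R]_n -> R) :
  (forall i, sphere_sos (F i)) -> sphere_sos (fun u => \prod_(i <- s) F i u).
Proof.
move=> HF; elim: s => [|i s IH].
  by apply: sphere_sos_eq (sphere_sos_const ler01) => u _; rewrite big_nil.
by apply: sphere_sos_eq (sphere_sosM (HF i) IH) => u _; rewrite big_cons.
Qed.

(* With [t] this signed coordinate, [2 (1 + t) = (1 + t) ^ 2 + (1 - t ^ 2)], and
   on the sphere [1 - t ^ 2] is the sum of the other squared coordinates. *)
Lemma sphere_sos_coord i (b : bool) : sphere_sos (fun u => 1 + (-1) ^+ b * u 0 i).
Proof.
have H : sphere_sos (fun u => 2^-1 * (peval (1 + (-1) ^+ b *: 'X_i) u ^+ 2 +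
    \sum_(j <- rem i (index_enum 'I_n)) peval 'X_j u ^+ 2)).
  apply: sphere_sosM; first by apply: sphere_sos_const; rewrite invr_ge0.
  apply: sphere_sosD; first exact: sphere_sos_sqr.
  by apply: sphere_sos_sum => j; apply: sphere_sos_sqr.
apply: sphere_sos_eq H => u u1.
have E : \sum_(j <- rem i (index_enum 'I_n)) peval 'X_j u ^+ 2 = 1 - u 0 i ^+ 2.
  have -> : 1 = u 0 i ^+ 2 + \sum_(j <- rem i (index_enum 'I_n)) u 0 j ^+ 2.
    rewrite -u1 /dot [LHS](big_rem i) ?mem_index_enum //= -expr2; congr (_ + _);
      by apply: eq_bigr => j _; rewrite expr2.
  by rewrite addrAC subrr add0r; apply: eq_bigr => j _; rewrite pevalXU.
by rewrite E !pevalE; case: b => /=; rewrite ?expr0 ?expr1; field.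
Qed.

(** One variable [y] per signed coordinate, with [x_i = n (y_(i,+) - y_(i,-))]: the simplex lands in
    the box of radius [n]. At [y_(i,+-) = (1 +- u_i) / (2n)] the point [u] is recovered; on the
    sphere these weights are sums of squares, and so are the definite forms [C w] evaluated at
    [h]. *)
Theorem matrix_Positivstellensatz k (S : 'I_k -> 'I_k -> {mpoly R[n]}) (mu : R)
    (h : 'I_k -> {mpoly R[n]}) : (0 < n)%N -> 0 < mu ->
  (forall x v, box n%:R x -> mu * dot v v <= qform (fun a b => peval (S a b) x) v) ->
  sphere_sos (fun u => qform (fun a b => peval (S a b) u) (\row_a peval (h a) u)).
Proof.
move=> n0 mu0 H; have nR : (0 : R) < n%:R by rewrite ltr0n.
pose K := ('I_n * bool)%type.
pose l (i : 'I_n) (k : K) : R := (k.1 == i)%:R * ((-1) ^+ k.2 * n%:R).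
have [D HD] : exists D, forall ab : 'I_k * 'I_k, exists c : {ffun 'I_D -> K} -> R,
    forall y, \sum_k y k = 1 -> peval (S ab.1 ab.2) (\row_i \sum_k y k * l i k) =
      \sum_(w : {ffun 'I_D -> K}) (\prod_j y (w j)) * c w.
  have [D0 HD0] := boolp.choice (fun ab : 'I_k * 'I_k => poly_words l (S ab.1 ab.2)).
  exists (\max_ab D0 ab) => ab; apply: (HD0 ab).
  exact: leq_bigmax.
have {HD} [c Hc] := boolp.choice HD.
have SE y v : \sum_k y k = 1 ->
    qform (fun a b => peval (S a b) (\row_i \sum_k y k * l i k)) v =
    \sum_(w : {ffun 'I_D -> K}) (\prod_j y (w j)) * qform (fun a b => c (a, b) w) v.
  move=> y1; under [RHS]eq_bigr do rewrite -qform_scale.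
  by rewrite -qform_sum; apply: eq_qform => a b; rewrite -(Hc (a, b)).
have [|M [C [Cpos CE]]] := Polya_posdef (c := fun w a b => c (a, b) w) mu0.
  move=> y y0 y1 v; rewrite -SE //; apply: H => i; rewrite mxE.
  apply: le_trans (ler_norm_sum _ _ _) _.
  have -> : n%:R = \sum_a y a * n%:R by rewrite -mulr_suml y1 mul1r.
  apply: ler_sum => k1 _.
  rewrite /l !normrM normr_sign mul1r (ger0_norm (y0 _)) (gtr0_norm nR) ler_wpM2l //.
  by case: eqP => _; rewrite ?normr1 ?normr0 ?mul1r ?mul0r ?(ltW nR).
pose y (u : 'rV[R]_n) (k : K) : R := (2 * n%:R)^-1 * (1 + (-1) ^+ k.2 * u 0 k.1).
have y1 u : \sum_k y u k = 1.
  rewrite -(pair_bigA _ (fun i b => y u (i, b))) /=.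
  rewrite (eq_bigr (fun=> n%:R^-1)) => [|i _].
    by rewrite sumr_const card_ord -[LHS]mulr_natl divff // gt_eqF.
  by rewrite big_bool /y /=; field; rewrite gt_eqF.
have yE u : \row_i \sum_k y u k * l i k = u.
  apply/rowP => i; rewrite mxE -(pair_bigA _ (fun a b => y u (a, b) * l i (a, b))) /=.
  rewrite (bigD1 i) //= [X in _ + X]big1 ?addr0 => [|j ji]; last first.
    by rewrite big1 // => b _; rewrite /l /= (negPf ji) mul0r mulr0.
  rewrite big_bool /y /l /= eqxx mulr1n.
  by field; rewrite gt_eqF.
have ysos b : sphere_sos (fun u => y u b).
  apply: sphere_sosM; last exact: sphere_sos_coord.
  by apply: sphere_sos_const; rewrite invr_ge0 mulr_ge0 // ltW.
have Csos w : sphere_sos (fun u => qform (C w) (\row_a peval (h a) u)).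
  have [s Hs] := posdef_sum_of_squares (Cpos w).
  exists [seq \sum_a t 0 a *: h a | t : 'rV[R]_k <- s] => u _.
  rewrite Hs big_map; apply: eq_bigr => t _; congr (_ ^+ 2).
  by rewrite peval_sum; apply: eq_bigr => a _; rewrite mxE pevalZ.
have := @sphere_sos_sum _ (index_enum _) _ (fun w : {ffun 'I_M -> K} => sphere_sosM
  (@sphere_sos_prod _ (index_enum _) _ (fun j => ysos (w j))) (Csos w)).
apply: sphere_sos_eq => u _.
by have := SE (y u) (\row_a peval (h a) u) (y1 u); rewrite yE CE.
Qed.

End SphereSOS.

(** * Polynomials with an isolated zero on the sphere *)

Section SphereZeros.
Variables (R : realType) (n : nat).
Implicit Types (p q : {mpoly R[n]}) (u v x z : 'rV[R]_n).

Lemma sphere_dim_gt0 u : dot u u = 1 -> (0 < n)%N.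
Proof.
by case: n u => // u /eqP; rewrite /dot big_ord0 eq_sym oner_eq0.
Qed.

Lemma sphere_sos_dim (F : 'rV[R]_n -> R) : ((0 < n)%N -> sphere_sos F) -> sphere_sos F.
Proof.
have [n0 H|n0 H] := posnP n; last exact: H.
by exists [::] => u /sphere_dim_gt0 h; exfalso; rewrite n0 in h.
Qed.

(** The case of 1 by 1 matrices with [h = 1]: a multiple of [(1 - |x|^2)^2], which vanishes exactly
    on the sphere, makes [p] positive on the box. *)
Lemma sphere_sos_pos p : (forall u, dot u u = 1 -> 0 < peval p u) ->
  sphere_sos (peval p).
Proof.
move=> pos; apply: sphere_sos_dim => n0.
pose A (_ _ : 'I_1) := p; pose B (_ _ : 'I_1) := (1 - sqnorm R n) ^+ 2.
have q1 (c : 'I_1 -> 'I_1 -> R) (v : 'rV[R]_1) : qform c v = dot v v * c ord0 ord0.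
  by rewrite /qform /dot !big_ord1.
have [|x v _ v0|C [mu [C0 mu0 H]]] := @Finsler R n 1 A B n%:R.
- by move=> x v; rewrite q1 /= !pevalE mulr_ge0 ?dot_ge0 // sqr_ge0.
- rewrite !q1 /= !pevalE peval_sqnorm => /eqP; rewrite mulf_eq0 sqrf_eq0.
  rewrite dot_eq0 (negPf v0) /= subr_eq0 eq_sym => /eqP x1.
  by rewrite mulr_gt0 ?dot_gt0 ?pos.
apply: sphere_sos_eq (matrix_Positivstellensatz (fun=> 1) n0 mu0 H) => u u1.
by rewrite q1 /= !pevalE peval_sqnorm u1 /dot big_ord1 !mxE ?peval1; ring.
Qed.

(* On the sphere [dot (u - z) z = - dot (u - z) (u - z) / 2], so the gradient
   at a critical point z, being a multiple of z, is absorbed in the quadratic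
   term of the Taylor expansion. *)
Lemma sphere_growth_Taylor p z (c r : R) :
  dot z z = 1 -> peval p z = 0 -> 0 < c -> 0 < r ->
  (forall u, dot u u = 1 -> near z r u -> c * dot (u - z) (u - z) <= peval p u) ->
  exists A : 'I_n -> 'I_n -> {mpoly R[n]},
    (forall u, dot u u = 1 -> peval p u = qform (fun a b => peval (A a b) u) (u - z)) /\
    (forall v, v != 0 -> dot v z = 0 -> 0 < qform (fun a b => peval (A a b) z) v).
Proof.
move=> z1 pz c0 r0 grow; have [T [HT _]] := Taylor2 z p.
pose G := gradient p z; pose gam := dot z G.
(* For a unit tangent vector [v] this is [((1 - t^2) z + 2 t v) / (1 + t^2)], the rational
   parametrization of the great circle through [z] in direction [v]. *)
pose cu (t : R) v := z + (2 * t / (1 + t ^+ 2)) *: (v - t *: z).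
have t2 (t : R) : 0 < 1 + t ^+ 2 by have := sqr_ge0 t => *; lra.
have cuB t v : cu t v - z = (2 * t / (1 + t ^+ 2)) *: (v - t *: z).
  by rewrite /cu addrC addKr.
have w2 t v : dot v v = 1 -> dot v z = 0 -> dot (v - t *: z) (v - t *: z) = 1 + t ^+ 2.
  by move=> v1 vz; rewrite !dotE (dotC z v) v1 vz z1; ring.
have cu1 t v : dot v v = 1 -> dot v z = 0 -> dot (cu t v) (cu t v) = 1.
  move=> v1 vz; rewrite /cu dotDl !dotDr !dotZl !dotZr w2 //.
  by rewrite !dotE (dotC z v) vz z1; field; rewrite gt_eqF.
have cu_near t v : dot v v = 1 -> dot v z = 0 -> forall s, 0 < s -> 0 < t -> 2 * t < s ->
    near z s (cu t v).
  move=> v1 vz s s0 t0 ts; apply: near_of_dot => //; rewrite cuB !dotZl dotZr w2 //.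
  have -> : 2 * t / (1 + t ^+ 2) * (2 * t / (1 + t ^+ 2) * (1 + t ^+ 2)) =
    (2 * t) ^+ 2 / (1 + t ^+ 2) by field; rewrite gt_eqF.
  rewrite ltr_pdivrMr //; have := sqr_ge0 (s * t) => ?; nra.
have tangent_ge0 v : dot v v = 1 -> dot v z = 0 -> 0 <= dot v G.
  move=> v1 vz; have [s s0 Hs] := qform_cont T z (ltr01 : 0 < (1 : R)).
  pose S := \sum_a \sum_b `|peval (T a b) z|.
  have S0 : 0 <= S by apply: sumr_ge0 => *; apply: sumr_ge0.
  have H t : 0 < t -> 2 * t < s -> 2 * t < r -> 0 <= dot v G - t * gam + 2 * t * (S + 1).
    move=> t0 ts tr.
    have := grow _ (cu1 t v v1 vz) (cu_near t v v1 vz r r0 t0 tr).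
    rewrite HT pz add0r cuB peval_dirZ qformZ peval_dir -/G dotBl dotZl -/gam.
    have := Hs _ (cu_near t v v1 vz s s0 t0 ts) (v - t *: z).
    have := qform_bound (fun a b => peval (T a b) z) (v - t *: z).
    rewrite dotZl dotZr w2 // -/S mul1r ler_norml => /andP[_ h1].
    rewrite ler_norml => /andP[_ h2].
    set Q := qform _ _ in h2 *; set k := 2 * t / (1 + t ^+ 2).
    have kE : k * (1 + t ^+ 2) = 2 * t by rewrite /k divfK // gt_eqF.
    have k0 : 0 < k by rewrite divr_gt0 // mulr_gt0.
    move=> h3.
    have h4 : 0 <= k * (dot v G - t * gam) + k ^+ 2 * Q.
      apply: le_trans h3; rewrite mulr_ge0 ?(ltW c0) //.
      by rewrite kE mulr_ge0 ?(ltW k0) // mulr_ge0 // ltW.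
    rewrite expr2 -mulrA -mulrDr pmulr_rge0 // in h4.
    have h5 : k * Q <= k * ((S + 1) * (1 + t ^+ 2)).
      by rewrite ler_wpM2l ?(ltW k0) //; lra.
    rewrite mulrCA kE in h5; lra.
  rewrite leNgt; apply/negP => D0.
  pose W := `|gam| + 2 * (S + 1) + 1.
  have W0 : 0 < W by rewrite /W; have := normr_ge0 gam => *; lra.
  pose t := Num.min (Num.min (s / 3) (r / 3)) (- dot v G / (2 * W)).
  have t0 : 0 < t by rewrite !lt_min !divr_gt0 ?oppr_gt0 // mulr_gt0.
  have ts : t <= s / 3 by rewrite /t !ge_min lexx.
  have tr : t <= r / 3 by rewrite /t !ge_min lexx orbT.
  have tW : t <= - dot v G / (2 * W) by rewrite /t !ge_min lexx orbT.
  rewrite ler_pdivlMr ?mulr_gt0 // in tW.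
  have h1 : 2 * t < s by lra.
  have h2 : 2 * t < r by lra.
  have h3 := H t t0 h1 h2.
  have h4 : - t * gam <= t * `|gam|.
    by rewrite mulNr -mulrN ler_wpM2l ?(ltW t0) // -normrN ler_norm.
  have : t * W = t * `|gam| + 2 * t * (S + 1) + t by rewrite /W; ring.
  by move=> ?; lra.
(* The slope is nonnegative along both [v] and [- v]. *)
have tangent0 v : dot v z = 0 -> dot v G = 0.
  move=> vz; have [->|v0] := eqVneq v 0; first by rewrite dot0l.
  have [a a0 [a1 _]] := normalize v0.
  have := tangent_ge0 _ a1; rewrite dotZl vz mulr0 => /(_ erefl).
  have := tangent_ge0 (- (a *: v)).
  rewrite !(dotNl (a *: v)) (dotNr (a *: v)) opprK a1 dotZl vz mulr0 oppr0 dotZl.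
  move=> /(_ erefl erefl).
  rewrite pmulr_rge0 // oppr_ge0 pmulr_rle0 // => h1 h2.
  by apply/le_anti/andP.
have GE : G = gam *: z.
  apply/eqP; rewrite -subr_eq0 -dot_eq0.
  have h : dot (G - gam *: z) z = 0 by rewrite !dotE z1 (dotC G) -/gam; ring.
  by rewrite dotBr tangent0 // dotZr h mulr0 subrr.
pose A a b := T a b - ((gam / 2) * (a == b)%:R)%:MP.
have AE u v : qform (fun a b => peval (A a b) u) v =
    qform (fun a b => peval (T a b) u) v - gam / 2 * dot v v.
  rewrite -qform_id -mulNr -qform_scale -qformD; apply: eq_qform => a b.
  by rewrite !pevalE mulNr.
have pA u : dot u u = 1 -> peval p u = qform (fun a b => peval (A a b) u) (u - z).
  move=> u1; rewrite HT pz add0r peval_dir -/G GE AE.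
  by rewrite !dotE (dotC z u) z1 u1; field.
exists A; split=> // v v0 vz.
have [a a0 [a1 _]] := normalize v0.
rewrite -(pmulr_rgt0 _ (_ : 0 < a ^+ 2)) ?exprn_gt0 // -qformZ.
have {v0 vz} : dot (a *: v) z = 0 by rewrite dotZl vz mulr0.
move: (a *: v) a1 => {}v v1 vz {a a0}.
(* On the circle the growth divides by the squared factor of [v - t *: z] and bounds the form of [A]
   there below by [c (1 + t^2)]. Passing to [z] and to [v] costs about [c / 4] each, which
   contradicts a value under [c / 2]. *)
suff h : c / 2 <= qform (fun a b => peval (A a b) z) v by lra.
rewrite leNgt; apply/negP => lt_c.
have c4 : 0 < c / 4 by lra.
have [s s0 Hs] := qform_cont A z c4.
have [q qE] := qform_poly (fun a b => peval (A a b) z).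
have [d d0 Hd] := poly_cont q v c4.
pose t := Num.min (Num.min (s / 3) (r / 3)) (d / 3).
have t0 : 0 < t by rewrite !lt_min !divr_gt0.
have ts : t <= s / 3 by rewrite /t !ge_min lexx.
have tr : t <= r / 3 by rewrite /t !ge_min lexx orbT.
have td : t <= d / 3 by rewrite /t !ge_min lexx orbT.
have /Hd : near v d (v - t *: z).
  apply: near_of_dot => //; rewrite addrC addKr !dotE z1; nra.
rewrite !qE ltr_norml => /andP[_ h1].
have h2 : 2 * t < s by lra.
have h3 : 2 * t < r by lra.
have := Hs _ (cu_near t v v1 vz s s0 t0 h2) (v - t *: z).
have := grow _ (cu1 t v v1 vz) (cu_near t v v1 vz r r0 t0 h3).
rewrite pA ?cu1 // cuB qformZ dotZl dotZr w2 //.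
have : 0 < 2 * t / (1 + t ^+ 2) by rewrite divr_gt0 // mulr_gt0.
move: (2 * t / (1 + t ^+ 2)) => k k0.
have -> : c * (k * (k * (1 + t ^+ 2))) = k ^+ 2 * (c * (1 + t ^+ 2)) by ring.
have {}k0 : 0 < k ^+ 2 by rewrite exprn_gt0.
rewrite ler_pM2l // ler_norml => h4 /andP[_ h5].
have := sqr_ge0 t => ?; nra.
Qed.

Lemma sphere_sos_single p z (c r : R) :
  dot z z = 1 -> peval p z = 0 -> 0 < c -> 0 < r ->
  (forall u, dot u u = 1 -> near z r u -> c * dot (u - z) (u - z) <= peval p u) ->
  (forall u, dot u u = 1 -> u != z -> 0 < peval p u) ->
  sphere_sos (peval p).
Proof.
move=> z1 pz c0 r0 grow pos.
have [A [pA Apos]] := sphere_growth_Taylor z1 pz c0 r0 grow.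
pose h (a : 'I_n) : {mpoly R[n]} := 'X_a - (z 0 a)%:MP.
pose g (a : 'I_n) : {mpoly R[n]} := 'X_a + (z 0 a)%:MP.
pose hh : {mpoly R[n]} := \sum_a h a ^+ 2.
(* The matrix [|u-z|^2 I - (u-z)(u-z)^T + (u+z)(u+z)^T] is semidefinite; on the
   sphere it annihilates [u - z], which spans its kernel unless [u = z], where
   the kernel is the tangent space. *)
pose B a b : {mpoly R[n]} := (a == b)%:R%:MP * (hh + (1 - sqnorm R n) ^+ 2)
   - h a * h b + g a * g b.
have hhE u : peval hh u = dot (u - z) (u - z).
  by rewrite peval_sum; apply: eq_bigr => a _; rewrite !pevalE !mxE expr2.
have BE u v : qform (fun a b => peval (B a b) u) v =
    (dot (u - z) (u - z) * dot v v - dot (u - z) v ^+ 2) + dot (u + z) v ^+ 2 +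
    (1 - dot u u) ^+ 2 * dot v v.
  have -> : qform (fun a b => peval (B a b) u) v = qform (fun a b =>
      (dot (u - z) (u - z) + (1 - dot u u) ^+ 2) * (a == b)%:R +
      (-1) * ((u - z) 0 a * (u - z) 0 b) + (u + z) 0 a * (u + z) 0 b) v.
    apply: eq_qform => a b; rewrite !pevalE hhE peval_sqnorm !mxE; ring.
  by rewrite !qformD !qform_scale qform_id !qform_rank1; ring.
have B0 u v : 0 <= qform (fun a b => peval (B a b) u) v.
  have := Cauchy_Schwarz (u - z) v; have := sqr_ge0 (dot (u + z) v).
  have := mulr_ge0 (sqr_ge0 (1 - dot u u)) (dot_ge0 v).
  by rewrite BE => *; lra.
(* Off the sphere the term [(1 - |x|^2)^2] makes [B] definite. On it, a kernel vector at [x != z] is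
   a multiple of [x - z], where [A] takes the value [p x > 0] up to a square; at [z] it is tangent
   and [Apos] applies. *)
have [x v _ v0|C [mu [C0 mu0 H]]] := @Finsler R n n A B n%:R B0.
  have CS := Cauchy_Schwarz (x - z) v; have sq := sqr_ge0 (dot (x + z) v).
  have sph := mulr_ge0 (sqr_ge0 (1 - dot x x)) (dot_ge0 v).
  rewrite BE => E.
  have : (1 - dot x x) ^+ 2 * dot v v = 0 by lra.
  move/eqP; rewrite mulf_eq0 sqrf_eq0 dot_eq0 (negPf v0) orbF subr_eq0 eq_sym.
  move=> /eqP x1.
  have [xz|xz] := eqVneq x z.
    rewrite xz; apply: Apos => //.
    have /eqP : dot (x + z) v ^+ 2 = 0 by lra.
    rewrite sqrf_eq0 xz dotDl -mulr2n mulrn_eq0 /= => /eqP.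
    by rewrite dotC.
  have xz0 : x - z != 0 by rewrite subr_eq0.
  have CSE : dot (x - z) (x - z) * dot v v = dot (x - z) v ^+ 2 by lra.
  have vE := Cauchy_Schwarz_eq xz0 CSE.
  move: v0; rewrite vE scaler_eq0 negb_or => /andP[k0 _].
  by rewrite qformZ -pA // mulr_gt0 ?pos // lt0r sqrf_eq0 k0 sqr_ge0.
have n0 := sphere_dim_gt0 z1.
apply: sphere_sos_eq (matrix_Positivstellensatz h n0 mu0 H) => u u1.
have -> : \row_a peval (h a) u = u - z.
  by apply/rowP => a; rewrite !mxE !pevalE.
have -> : qform (fun a b => peval (A a b + C *: B a b) u) (u - z) =
   qform (fun a b => peval (A a b) u) (u - z) +
   C * qform (fun a b => peval (B a b) u) (u - z).
  by rewrite -qform_scale -qformD; apply: eq_qform => a b; rewrite !pevalE.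
have E : dot (u + z) (u - z) = 0 by rewrite !dotE (dotC z u) u1 z1; ring.
by rewrite -pA // BE E u1; ring.
Qed.

End SphereZeros.

(** * Constraints on the sphere *)

Section Damping.
Variable R : realType.
Implicit Types (x y c d : R).

Lemma archi_mul c d : 0 < d -> exists k : nat, forall k', (k <= k')%N -> c < k'%:R * d.
Proof.
move=> d0; exists (Num.truncn (c / d)).+1 => k' kk'; rewrite -ltr_pdivrMr //.
by apply: lt_le_trans (truncnS_gt _) _; rewrite ler_nat.
Qed.

Lemma Bernoulli y k : 0 <= y -> 1 + k%:R * y <= (1 + y) ^+ k.
Proof.
move=> y0; elim: k => [|k IH]; first by rewrite mul0r addr0 expr0.
rewrite exprS -natr1; have := ler0n R k => ?; nra.
Qed.

(** Stands for a damped constraint with [x = g_j / N]. On [[-1, 1]] it is nonincreasing in [k],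
    tending to 0 for [x >= 0] and to minus infinity for [x < 0]. *)
Definition damp k x := ((1 - x) ^+ k) ^+ 2 * x.

Lemma damp_mono k k' x : -1 <= x <= 1 -> (k <= k')%N -> damp k' x <= damp k x.
Proof.
move=> /andP[x1 x2] /subnK <-; elim: (_ - _)%N => [|j IH]; first by rewrite add0n.
apply: le_trans IH; rewrite /damp addSn (exprS (1 - x)) exprMn.
have := sqr_ge0 ((1 - x) ^+ (j + k)); set A := _ ^+ 2 => A0.
have : 0 <= A * (x ^+ 2 * (2 - x)) by apply: mulr_ge0 => //; apply: mulr_ge0; [exact: sqr_ge0 | lra].
by move=> ?; nra.
Qed.

(** By Bernoulli, [(1 - x)^k (1 + k x) <= (1 - x^2)^k <= 1]. *)
Lemma damp_nonneg_le k x : 0 <= x <= 1 -> k%:R * damp k x <= 1.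
Proof.
move=> /andP[x0 x1]; rewrite /damp.
have A0 : 0 <= (1 - x) ^+ k by rewrite exprn_ge0 // subr_ge0.
have A1 : (1 - x) ^+ k <= 1 by rewrite exprn_ile1 // ?subr_ge0 //; lra.
have h : (1 - x) ^+ k * (1 + k%:R * x) <= 1.
  apply: (@le_trans _ _ ((1 - x) ^+ k * (1 + x) ^+ k)).
    by rewrite ler_wpM2l // Bernoulli.
  rewrite -exprMn exprn_ile1 //; nra.
move: A0 A1 h; set A := (1 - x) ^+ k => A0 A1 h.
have kx : 0 <= k%:R * x by rewrite mulr_ge0.
have : A ^+ 2 * (k%:R * x) <= A * (k%:R * x) by rewrite ler_wpM2r // expr2 ler_piMl.
by move=> ?; lra.
Qed.

Lemma damp_le1 k x : -1 <= x <= 1 -> damp k x <= 1.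
Proof.
move=> x1; apply: le_trans (damp_mono x1 (leq0n k)) _.
by rewrite /damp expr0 expr1n mul1r; case/andP: x1.
Qed.

Lemma damp_neg_le k x : x < 0 -> damp k x <= - (k%:R * x ^+ 2).
Proof.
move=> x0; rewrite /damp.
have h := @Bernoulli (- x) k ltac:(lra).
have k0 := ler0n R k.
have y0 : 0 <= k%:R * - x by rewrite mulr_ge0 //; lra.
move: h y0; set A := (1 - x) ^+ k => h y0.
have : (1 + k%:R * - x) <= A ^+ 2 by nra.
by move=> ?; nra.
Qed.

End Damping.

(** * Positivity certificates on the feasible part of the sphere *)

Section ConstrainedSphere.
Variables (R : realType) (n m : nat) (g : m.-tuple {mpoly R[n]}).
Implicit Types (p q F b : {mpoly R[n]}) (u v x z : 'rV[R]_n) (a : 'I_m -> {mpoly R[n]}).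

Definition sphere_feasible u := dot u u = 1 /\ basic_closed_set g u.

Definition sphere_qm (F : 'rV[R]_n -> R) :=
  exists (s0 : 'rV[R]_n -> R) (s : 'I_m -> 'rV[R]_n -> R),
    [/\ sphere_sos s0, forall j, sphere_sos (s j) &
        forall u, dot u u = 1 -> F u = s0 u + \sum_j peval (tnth g j) u * s j u].

Lemma sphere_qm_eq (F G : 'rV[R]_n -> R) : (forall u, dot u u = 1 -> F u = G u) ->
  sphere_qm G -> sphere_qm F.
Proof. by move=> FG [s0 [s [h0 h H]]]; exists s0, s; split=> // u u1; rewrite FG ?H. Qed.

Lemma sphere_qmD (F G : 'rV[R]_n -> R) :
  sphere_qm F -> sphere_qm G -> sphere_qm (fun u => F u + G u).
Proof.
move=> [s0 [s [h0 h H]]] [s0' [s' [h0' h' H']]].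
exists (fun u => s0 u + s0' u), (fun j u => s j u + s' j u); split=> [|j|u u1].
- exact: sphere_sosD.
- exact: sphere_sosD.
rewrite H // H' // addrACA -big_split; congr (_ + _).
by apply: eq_bigr => j _; rewrite mulrDr.
Qed.

Lemma sphere_qm_sosM (F G : 'rV[R]_n -> R) :
  sphere_sos G -> sphere_qm F -> sphere_qm (fun u => G u * F u).
Proof.
move=> hG [s0 [s [h0 h H]]].
exists (fun u => G u * s0 u), (fun j u => G u * s j u); split=> [|j|u u1].
- exact: sphere_sosM.
- exact: sphere_sosM.
rewrite H // mulrDr mulr_sumr; congr (_ + _).
by apply: eq_bigr => j _; rewrite mulrCA.
Qed.

Lemma sphere_feasible_closed : closed_set sphere_feasible.
Proof.
move=> x nx; have [x1|x1] := boolp.EM (dot x x = 1); last first.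
  have [r r0 Hr] := closed_sphere x1.
  by exists r => // u /Hr u1 [].
have /boolp.existsNP[j /negP] : ~ basic_closed_set g x by move=> xg; apply: nx.
rewrite -ltNge -oppr_gt0 -pevalN => /poly_pos_near[r r0 Hr].
by exists r => // u /Hr; rewrite pevalN oppr_gt0 ltNge => /negP ug [_ /(_ j)].
Qed.

Lemma sphere_feasible_box u : sphere_feasible u -> box 1 u.
Proof. by move=> [/sphere_box]. Qed.

(** A common scale bringing all constraints into the interval where [damp] is monotone in [k]. *)
Lemma constraint_bound : exists2 N : R, 0 < N &
  forall j u, dot u u = 1 -> -1 <= peval (tnth g j) u / N <= 1.
Proof.
have bound j : exists C : R, 0 < C /\ forall u, box 1 u -> `|peval (tnth g j) u| <= C.
  by have [C C0 HC] := poly_bounded (tnth g j) 1; exists C.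
have [C HC] := boolp.choice bound.
have C0 j : 0 <= C j by have [/ltW] := HC j.
have N0 : 0 < 1 + \sum_j C j by rewrite ltr_wpDr //; apply: sumr_ge0 => j _.
exists (1 + \sum_j C j) => // j u /sphere_box u1.
have [_ /(_ u u1)] := HC j; rewrite ler_norml => /andP[h1 h2].
have h3 : C j <= 1 + \sum_j C j.
  by rewrite (bigD1 j) //= addrCA lerDl addr_ge0 //; apply: sumr_ge0 => i _.
rewrite ler_pdivlMr // ler_pdivrMr //; apply/andP; split; lra.
Qed.

Variable N : R.
Hypothesis N_gt0 : 0 < N.
Hypothesis gN : forall j u, dot u u = 1 -> -1 <= peval (tnth g j) u / N <= 1.

(* Subtracting a weighted square multiple of each [g_j], damped where [g_j > 0]
   and amplified where [g_j < 0]. *)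
Definition pert a k F : {mpoly R[n]} :=
  F - \sum_j (a j * (1 - N^-1 *: tnth g j) ^+ k) ^+ 2 * tnth g j.

Lemma peval_pert a k F u : peval (pert a k F) u =
  peval F u - N * \sum_j peval (a j) u ^+ 2 * damp k (peval (tnth g j) u / N).
Proof.
rewrite pevalB peval_sum mulr_sumr; congr (_ - _); apply: eq_bigr => j _.
rewrite /damp !pevalE [peval _ u / N]mulrC exprMn.
by field; rewrite gt_eqF.
Qed.

Lemma pert_mono a k k' F u : dot u u = 1 -> (k <= k')%N ->
  peval (pert a k F) u <= peval (pert a k' F) u.
Proof.
move=> u1 kk'; rewrite !peval_pert lerD2l lerN2 ler_pM2l //.
by apply: ler_sum => j _; rewrite ler_wpM2l ?sqr_ge0 // damp_mono ?gN.
Qed.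

Lemma pert_le a k F u : sphere_feasible u -> peval (pert a k F) u <= peval F u.
Proof.
move=> [u1 ug]; rewrite pevalB gerBl peval_sum sumr_ge0 // => j _.
by rewrite pevalM pevalXn mulr_ge0 ?sqr_ge0 // ug.
Qed.

Lemma sphere_qm_pert a k F : sphere_sos (peval (pert a k F)) -> sphere_qm (peval F).
Proof.
move=> H; exists (peval (pert a k F)).
exists (fun j u => peval (a j * (1 - N^-1 *: tnth g j) ^+ k) u ^+ 2).
split=> [//|j|u u1]; first exact: sphere_sos_sqr.
rewrite pevalB peval_sum -addrA [X in _ = _ + X](_ : _ = 0) ?addr0 //.
rewrite -sumrN -big_split big1 // => j _ /=.
by rewrite [peval (_ * _) u]pevalM pevalXn mulrC addNr.
Qed.

(** At a feasible point the subtracted sum is at most [N * S / k]. At an infeasible one a violated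
    constraint, whose weight is nonzero, gains at least a positive multiple of [k], while the others
    lose at most [N * S]. *)
Lemma pert_pos_eventually a F x : dot x x = 1 ->
  (sphere_feasible x -> 0 < peval F x) -> (forall j, peval (a j) x != 0) ->
  exists k, 0 < peval (pert a k F) x.
Proof.
move=> x1 Fx ax; have t0 j : 0 < peval (a j) x ^+ 2 by rewrite lt0r sqrf_eq0 ax sqr_ge0.
pose S := \sum_j peval (a j) x ^+ 2.
have S0 : 0 <= S by apply: sumr_ge0 => j _; apply: ltW.
have [xg|/boolp.existsNP[j0 /negP]] := boolp.EM (basic_closed_set g x).
  have [k0 Hk] := archi_mul (N * S) (Fx (conj x1 xg)).
  exists k0.+1; have {Hk} := Hk k0.+1 (leqnSn _); set k := k0.+1 => Hk.
  rewrite peval_pert subr_gt0 -(@ltr_pM2l _ k%:R) ?ltr0n //.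
  apply: le_lt_trans Hk; rewrite mulrCA ler_pM2l // mulr_sumr; apply: ler_sum => j _.
  rewrite mulrCA ler_piMr ?(ltW (t0 j)) // damp_nonneg_le //.
  by rewrite divr_ge0 ?(ltW N_gt0) ?xg //=; case/andP: (gN j x1).
rewrite -ltNge => xg.
pose y := peval (tnth g j0) x / N.
have y0 : y < 0 by rewrite ltr_pdivrMr // mul0r.
have y2 : 0 < N * (peval (a j0) x ^+ 2 * y ^+ 2).
  by apply: mulr_gt0 => //; apply: mulr_gt0; rewrite // lt0r sqrf_eq0 sqr_ge0 lt_eqF.
have [k Hk] := archi_mul (N * S - peval F x) y2; exists k.
rewrite peval_pert (bigD1 j0) //= -/y.
have h1 : \sum_(j | j != j0) peval (a j) x ^+ 2 * damp k (peval (tnth g j) x / N) <= S.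
  apply: (@le_trans _ _ (\sum_(j | j != j0) peval (a j) x ^+ 2)).
    by apply: ler_sum => j _; rewrite ler_piMr ?(ltW (t0 j)) // damp_le1 ?gN.
  by rewrite /S [X in _ <= X](bigD1 j0) //= lerDr ltW.
have h2 : peval (a j0) x ^+ 2 * damp k y <= - (k%:R * (peval (a j0) x ^+ 2 * y ^+ 2)).
  rewrite [k%:R * _]mulrCA -(mulrN (peval (a j0) x ^+ 2)) ler_pM2l //.
  exact: damp_neg_le.
move: h1 h2 (Hk k (leqnn _)); set A := \sum_(j | _) _; set B := _ * damp k y.
move=> h1 h2 h3.
have h4 := lerD h2 h1; rewrite -(ler_pM2l N_gt0) in h4.
by lra.
Qed.

(** A Dini argument: positivity at one point for one [k] spreads to a neighbourhood by continuity
    and to all larger exponents by monotonicity. Around points of [Z], where the value may vanish,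
    the neighbourhood is supplied by hypothesis. *)
Lemma pert_pos_uniform a F (Z : 'rV[R]_n -> Prop) k0 :
  (forall x, dot x x = 1 -> Z x -> exists k r, 0 < r /\
     forall u, dot u u = 1 -> near x r u -> ~ Z u -> 0 < peval (pert a k F) u) ->
  (forall x, dot x x = 1 -> ~ Z x ->
     (sphere_feasible x -> 0 < peval F x) /\ forall j, peval (a j) x != 0) ->
  exists2 k, (k0 <= k)%N & forall u, dot u u = 1 -> ~ Z u -> 0 < peval (pert a k F) u.
Proof.
move=> HZ HnZ.
pose P (X : 'rV[R]_n -> Prop) := exists k, forall u, dot u u = 1 -> X u -> ~ Z u ->
  0 < peval (pert a k F) u.
have [||||k H] := @compact_ind R n (fun u => dot u u = 1) 1 P (@sphere_box R n) (@closed_sphere R n).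
- by move=> A B AB [k Hk]; exists k => u u1 /AB; apply: Hk.
- move=> A B [k Hk] [k' Hk']; exists (maxn k k') => u u1 AB nZ.
  case: AB => [Au|Bu].
    exact: lt_le_trans (Hk u u1 Au nZ) (pert_mono _ _ u1 (leq_maxl _ _)).
  exact: lt_le_trans (Hk' u u1 Bu nZ) (pert_mono _ _ u1 (leq_maxr _ _)).
- by exists 0%N.
- move=> x x1; have [Zx|nZx] := boolp.EM (Z x).
    have [k [r [r0 Hk]]] := HZ x x1 Zx.
    by exists r => //; exists k => u u1 [_ xu]; apply: Hk.
  have [Fx ax] := HnZ x x1 nZx.
  have [k /poly_pos_near[r r0 Hr]] := pert_pos_eventually x1 Fx ax.
  by exists r => //; exists k => u _ [_ /Hr].
exists (maxn k k0); first exact: leq_maxr.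
move=> u u1 nZ.
exact: lt_le_trans (H u u1 u1 nZ) (pert_mono _ _ u1 (leq_maxl _ _)).
Qed.

(** Nonvanishing of the weights off [z] serves [pert_pos_eventually] there; [a j * g_j = 0] at [z]
    makes the perturbation keep the value of [F] at [z]. *)
Definition local_growth F z := exists a k c r, [/\
  forall j u, dot u u = 1 -> u != z -> peval (a j) u != 0,
  forall j, peval (a j) z * peval (tnth g j) z = 0,
  0 < c, 0 < r &
  forall u, dot u u = 1 -> near z r u -> c * dot (u - z) (u - z) <= peval (pert a k F) u].

Lemma dotB_gt0 u z : (0 < dot (u - z) (u - z)) = (u != z).
Proof. by rewrite dot_gt0 subr_eq0. Qed.

(** An exponent beyond [k0] retains the growth at [z] by monotonicity and gives positivity
    elsewhere, so the perturbed polynomial falls under [sphere_sos_single]. *)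
Lemma sphere_qm_single F z : dot z z = 1 -> peval F z = 0 -> local_growth F z ->
  (forall u, sphere_feasible u -> u != z -> 0 < peval F u) -> sphere_qm (peval F).
Proof.
move=> z1 Fz [a [k0 [c [r [a0 az c0 r0 grow]]]]] pos.
have [x x1 ->|x x1 /eqP xz|k kk0 H] := @pert_pos_uniform a F (fun u => u = z) k0.
- exists k0, r; split=> // u u1 zu /eqP uz; apply: lt_le_trans (grow u u1 zu).
  by rewrite mulr_gt0 // dotB_gt0.
- by split=> [/pos|j]; [apply | apply: a0].
apply: (sphere_qm_pert (a := a) (k := k)).
apply: (sphere_sos_single z1 _ c0 r0) => [|u u1 zu|u u1 /eqP]; last exact: H.
  rewrite pevalB Fz peval_sum big1 ?subrr // => j _.
  have E (A B C : R) : (A * B) ^+ 2 * C = A * C * (A * B ^+ 2) by ring.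
  by rewrite pevalM pevalXn pevalM E az mul0r.
exact: le_trans (grow u u1 zu) (pert_mono _ _ u1 kk0).
Qed.

Lemma sphere_qm_pos F :
  (forall u, sphere_feasible u -> 0 < peval F u) -> sphere_qm (peval F).
Proof.
move=> pos.
have [//|x x1 _|k _ H] := @pert_pos_uniform (fun=> 1) F (fun=> False) 0.
  by split=> [/pos //|j]; rewrite peval1 oner_neq0.
apply: (sphere_qm_pert (a := fun=> 1) (k := k)).
by apply: sphere_sos_pos => u u1; apply: H.
Qed.

Lemma local_growth_le F z : local_growth F z -> exists c r, [/\ 0 < c, 0 < r &
  forall u, sphere_feasible u -> near z r u -> c * dot (u - z) (u - z) <= peval F u].
Proof.
move=> [a [k [c [r [_ _ c0 r0 grow]]]]]; exists c, r; split=> // u fu zu.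
have [u1 _] := fu.
exact: le_trans (grow u u1 zu) (pert_le _ _ _ fu).
Qed.

(** The same weights and exponent serve: a correction of order [|u - z|^2] with a small coefficient
    costs at most half of the growth constant. *)
Lemma local_growth_add F b z (C : R) : local_growth F z -> 
  (forall u, dot u u = 1 -> `|peval b u| <= C * dot (u - z) (u - z)) ->
  exists2 e0 : R, 0 < e0 & forall e, 0 < e <= e0 -> local_growth (F + e *: b) z.
Proof.
move=> [a [k [c [r [a0 az c0 r0 grow]]]]] bC.
have C1 : 0 < 2 * (`|C| + 1) by have := normr_ge0 C => *; lra.
exists (c / (2 * (`|C| + 1))); first by rewrite divr_gt0.
move=> e /andP[e0]; rewrite ler_pdivlMr // => eC.
exists a, k, (c / 2), r; split=> //; first lra.
move=> u u1 zu; rewrite /pert addrAC pevalD pevalZ -/(pert a k F).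
have := grow u u1 zu; have := bC u u1; have := dot_ge0 (u - z).
set D := dot _ _ => D0; rewrite ler_norml => /andP[h1 _] h2.
have h3 : C * D <= `|C| * D by rewrite ler_wpM2r // ler_norm.
have h4 : e * - (C * D) <= e * peval b u by rewrite ler_pM2l.
have h5 : e * (C * D) <= e * (`|C| * D) by rewrite ler_pM2l.
have h6 : e * (2 * (`|C| + 1)) * D <= c * D by rewrite ler_wpM2r.
have h7 : 0 <= e * D by rewrite mulr_ge0 // ltW.
by lra.
Qed.

(** Near a point with [F > 0] a small [e] does no harm; near one with [b > 0] any [e > 0] helps,
    since [F >= 0]; near a point of [Z] the growth of [F] dominates [e *: b]. Compactness yields a
    common bound. *)
Lemma pos_add_uniform F b (Z : seq 'rV[R]_n) :
  (forall u, sphere_feasible u -> 0 <= peval F u) ->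
  (forall x, sphere_feasible x -> [\/ 0 < peval F x, 0 < peval b x |
     [/\ x \in Z, local_growth F x & exists C, forall u, dot u u = 1 ->
        `|peval b u| <= C * dot (u - x) (u - x)]]) ->
  exists2 e0 : R, 0 < e0 & forall e, 0 < e <= e0 ->
    forall u, sphere_feasible u -> u \notin Z -> 0 < peval (F + e *: b) u.
Proof.
move=> F0 Hx.
pose P (X : 'rV[R]_n -> Prop) := exists2 e0 : R, 0 < e0 & forall e, 0 < e <= e0 ->
    forall u, X u -> sphere_feasible u -> u \notin Z -> 0 < peval (F + e *: b) u.
have [||||e0 e00 H] := @compact_ind R n sphere_feasible 1 P sphere_feasible_box sphere_feasible_closed.
- by move=> A B AB [e0 e00 H]; exists e0 => // e he u /AB; apply: H.
- move=> A B [e0 e00 H] [e1 e10 H1]; exists (Num.min e0 e1); first by rewrite lt_min e00.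
  move=> e; rewrite le_min => /and3P[? ? ?] u [Au|Bu].
    by apply: H => //; apply/andP.
  by apply: H1 => //; apply/andP.
- by exists 1.
- move=> x fx; case: (Hx x fx) => [Fx|bx|[xZ gx [C bC]]].
  + have [r r0 Hr] := @poly_cont R n F x (peval F x / 2) ltac:(lra).
    have [B B0 HB] := poly_bounded b 1.
    exists r => //; exists (peval F x / (4 * B)); first by rewrite divr_gt0 // mulr_gt0.
    move=> e /andP[e0]; rewrite ler_pdivlMr ?mulr_gt0 // => eB u [fu /Hr].
    rewrite ltr_norml => /andP[h1 _] _ _.
    have := HB u (sphere_feasible_box fu); rewrite ler_norml => /andP[h2 _].
    have h3 : e * - B <= e * peval b u by rewrite ler_pM2l.
    by rewrite pevalD pevalZ; lra.
  + have [r r0 Hr] := poly_pos_near bx.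
    exists r => //; exists 1 => // e /andP[e0 _] u [fu /Hr bu] _ _.
    by rewrite pevalD pevalZ ltr_wpDl ?F0 // mulr_gt0.
  + have [e0 e00 He] := local_growth_add gx bC.
    have [c1 [r1 [c10 r10 H1]]] := local_growth_le gx.
    have C1 : 0 < `|C| + 1 by have := normr_ge0 C => *; lra.
    exists r1 => //; exists (c1 / (2 * (`|C| + 1))); first by rewrite divr_gt0 // mulr_gt0.
    move=> e /andP[e_0]; rewrite ler_pdivlMr ?mulr_gt0 // => eC u [fu xu] _ uZ.
    have : 0 < dot (u - x) (u - x).
      by rewrite dotB_gt0; apply: contraNneq uZ => ->.
    have [u1 _] := fu; have := H1 u fu xu; have := bC u u1; rewrite pevalD pevalZ.
    set D := dot _ _; rewrite ler_norml => /andP[h1 _] h2 D0.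
    have h3 : C * D <= `|C| * D by rewrite ler_wpM2r ?ler_norm // ltW.
    have h4 : e * - (C * D) <= e * peval b u by rewrite ler_pM2l.
    have h5 : e * (C * D) <= e * (`|C| * D) by rewrite ler_pM2l.
    have h6 : e * (2 * (`|C| + 1)) * D <= c1 * D by rewrite ler_wpM2r // ltW.
    have h7 : 0 < e * D by rewrite mulr_gt0.
    have h8 : 0 <= e * (`|C| * D) by rewrite !mulr_ge0 // ltW.
    by lra.
exists e0 => // e he u fu; exact: (H e he u fu fu).
Qed.

End ConstrainedSphere.

(** * Splitting off the zeros *)

Section Peak.
Variables (R : realType) (n : nat).
Implicit Types (u x z : 'rV[R]_n).

(** On the unit sphere this is half the squared distance to the unit vector [z]. *)
Definition height z : {mpoly R[n]} := 1 - \sum_i z 0 i *: 'X_i.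

Lemma peval_height z u : peval (height z) u = 1 - dot z u.
Proof.
rewrite pevalB peval1 peval_sum; congr (_ - _); apply: eq_bigr => i _.
by rewrite !pevalE.
Qed.

Lemma dist_sphere z u : dot z z = 1 -> dot u u = 1 ->
  dot (u - z) (u - z) = 2 * (1 - dot z u).
Proof. by move=> z1 u1; rewrite !dotE z1 u1 (dotC u z); ring. Qed.

Lemma dot_sphere_bound z u : dot z z = 1 -> dot u u = 1 -> 0 <= 1 - dot z u <= 2.
Proof.
move=> z1 u1; have := Cauchy_Schwarz z u; rewrite z1 u1 mulr1 => h.
by apply/andP; split; nra.
Qed.

Lemma Bernoulli_decreasing (y : R) k : 0 <= y <= 1 -> 1 - k%:R * y <= (1 - y) ^+ k <= 1.
Proof.
move=> /andP[y0 y1]; elim: k => [|k /andP[IH1 IH2]].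
  by rewrite mul0r subr0 expr0 lexx.
rewrite exprS -natr1; have := ler0n R k => k0.
have p0 : 0 <= (1 - y) ^+ k by rewrite exprn_ge0 // subr_ge0.
by apply/andP; split; nra.
Qed.

(** With [d] the height of [u] and [de] that of [x], the factor [1 - d / de] vanishes at [x] but may
    exceed 1 in absolute value. The power of [1 - d / 2] compensates: [1 + d / de <= (1 + d / 2)^k]
    by Bernoulli once [k * de >= 2]. *)
Lemma peak_factor z x : dot z z = 1 -> dot x x = 1 -> x != z ->
  exists (t : {mpoly R[n]}) (C : R), 0 <= C /\ forall u, dot u u = 1 ->
    [/\ `|peval t u| <= 1, 1 - peval t u <= C * dot (u - z) (u - z) &
        peval t u ^+ 2 <= C * dot (u - x) (u - x)].
Proof.
move=> z1 x1 xz; pose de : R := 1 - dot z x.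
have de0 : 0 < de.
  have : 0 < dot (x - z) (x - z) by rewrite dotB_gt0.
  by rewrite dist_sphere // -/de => ?; lra.
have [k Hk] := archi_mul 2 de0; move: (Hk k (leqnn _)) => {}Hk.
pose t := (1 - de^-1 *: height z) * (1 - 2^-1 *: height z) ^+ k.
(* The first two terms serve the bound on [1 - t], the last one that on [t ^ 2]. *)
pose C := de^-1 + k%:R + de^-1 ^+ 2.
have dei : 0 < de^-1 by rewrite invr_gt0.
have k0 := ler0n R k.
have C0 : 0 <= C by rewrite !addr_ge0 // ?sqr_ge0 // ltW.
exists t, C; split=> // u u1.
have tE : peval t u = (1 - de^-1 * (1 - dot z u)) * (1 - 2^-1 * (1 - dot z u)) ^+ k.
  by rewrite -peval_height !pevalE.
rewrite dist_sphere // tE.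
set d := 1 - dot z u; have /andP[d0 d2] : 0 <= d <= 2 := dot_sphere_bound z1 u1.
have yE : 2^-1 * d = d / 2 by rewrite mulrC.
have sE : (1 - de^-1 * d) ^+ 2 <= de^-1 ^+ 2 * dot (u - x) (u - x).
  have -> : 1 - de^-1 * d = de^-1 * dot z (u - x).
    by rewrite dotBr /d /de; field; rewrite gt_eqF.
  rewrite exprMn ler_wpM2l ?sqr_ge0 //.
  by have := Cauchy_Schwarz z (u - x); rewrite z1 mul1r.
rewrite yE; have y01 : 0 <= d / 2 <= 1 by apply/andP; split; lra.
have /andP[B1 B2] := Bernoulli_decreasing k y01.
have Y0 : 0 <= (1 - d / 2) ^+ k by rewrite exprn_ge0 // subr_ge0; case/andP: y01.
have Bup : (1 + de^-1 * d) * (1 - d / 2) ^+ k <= 1.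
  apply: (@le_trans _ _ ((1 + d / 2) ^+ k * (1 - d / 2) ^+ k)).
    rewrite ler_wpM2r //; apply: le_trans (Bernoulli k _); last by case/andP: y01.
    rewrite lerD2l (_ : k%:R * (d / 2) = k%:R / 2 * d); last by ring.
    by rewrite ler_wpM2r // -[de^-1]mul1r ler_pdivrMr //; lra.
  rewrite -exprMn exprn_ile1 //; nra.
move: sE B1 B2 Y0 Bup; set Y := (1 - d / 2) ^+ k; set e := de^-1 * d.
have e0 : 0 <= e by rewrite mulr_ge0 // ltW.
have dx := dot_ge0 (u - x); move: dx; set dx := dot _ _ => dx0.
move=> sE B1 B2 Y0 Bup; split.
- by rewrite ler_norml; apply/andP; split; nra.
- have h : 0 <= k%:R * d by rewrite mulr_ge0.
  have h2 : 0 <= de^-1 ^+ 2 * d by rewrite mulr_ge0 ?sqr_ge0.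
  have h3 : C * (2 * d) = 2 * e + 2 * (k%:R * d) + 2 * (de^-1 ^+ 2 * d).
    by rewrite /C /e; ring.
  by rewrite h3; nra.
- rewrite exprMn; apply: (@le_trans _ _ (de^-1 ^+ 2 * dx)).
    apply: le_trans sE; rewrite ler_piMr ?sqr_ge0 // expr_le1 //.
  by rewrite ler_wpM2r // /C lerDr addr_ge0 // ltW.
Qed.

(** One [peak_factor] for each point of [Z], times [1 - d / 2], which makes the peak at [z]
    strict. *)
Lemma peak_poly z (Z : seq 'rV[R]_n) : dot z z = 1 ->
  (forall x, x \in Z -> dot x x = 1 /\ x != z) ->
  exists (t : {mpoly R[n]}) (C : R), 0 <= C /\ forall u, dot u u = 1 ->
    [/\ `|peval t u| <= 1 - dot (u - z) (u - z) / 4,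
        1 - peval t u <= C * dot (u - z) (u - z) &
        forall x, x \in Z -> peval t u ^+ 2 <= C * dot (u - x) (u - x)].
Proof.
move=> z1; elim: Z => [|x Z IH] HZ.
  exists (1 - 2^-1 *: height z), 1; split=> // u u1.
  have /andP[d0 d2] := dot_sphere_bound z1 u1.
  have -> : peval (1 - 2^-1 *: height z) u = 1 - 2^-1 * (1 - dot z u).
    by rewrite -peval_height !pevalE.
  rewrite dist_sphere //; split=> //.
    by rewrite ger0_norm; lra.
  by lra.
have [|t [C [C0 Ht]]] := IH; first by move=> y yZ; apply: HZ; rewrite inE yZ orbT.
have [x1 xz] := HZ x (mem_head _ _).
have [t' [C' [C'0 Ht']]] := peak_factor z1 x1 xz.
exists (t * t'), (C + C'); split=> [|u u1]; first exact: addr_ge0.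
have [a1 a2 a3] := Ht u u1; have [b1 b2 b3] := Ht' u u1.
have dz := dot_ge0 (u - z); rewrite pevalM.
have t1 : `|peval t u| <= 1 by lra.
split.
- by rewrite normrM (le_trans _ a1) // ler_piMr.
- have b1' : 0 <= 1 - peval t' u by move: b1; rewrite ler_norml => /andP[]; lra.
  have : peval t u * (1 - peval t' u) <= 1 - peval t' u.
    by rewrite ler_piMl // (le_trans (ler_norm _)).
  by move=> ?; nra.
- move=> y yZ; have dy := dot_ge0 (u - y); rewrite exprMn.
  have n1 (s : R) : `|s| <= 1 -> s ^+ 2 <= 1 by move=> s1; rewrite -real_normK ?num_real // expr_le1.
  have := n1 _ t1; have := n1 _ b1; have := sqr_ge0 (peval t u); have := sqr_ge0 (peval t' u).
  move: yZ; rewrite inE => /orP[/eqP yx|/a3].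
    by rewrite yx in dy *; move: b3; nra.
  by nra.
Qed.

End Peak.

(** * Induction on the number of zeros *)

Section FiniteZeros.
Variables (R : realType) (n m : nat) (g : m.-tuple {mpoly R[n]}) (N : R).
Hypothesis N_gt0 : 0 < N.
Hypothesis gN : forall j u, dot u u = 1 -> -1 <= peval (tnth g j) u / N <= 1.
Implicit Types (F : {mpoly R[n]}) (u x z : 'rV[R]_n).

(* The zeros are split off one at a time: with a square p peaking at z and
   vanishing at the other zeros, F = p (F + e b) + (1 - p) (F + e b') where
   b = (1 - p) (1 - 2 p) and b' = p (2 p - 1); for small e, F + e b vanishes
   at z only and F + e b' at the other zeros only. *)
Lemma sphere_qm_finite_zeros (Z : seq 'rV[R]_n) F : uniq Z ->
  (forall z, z \in Z -> [/\ sphere_feasible g z, peval F z = 0 & local_growth g N F z]) ->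
  (forall u, sphere_feasible g u -> u \notin Z -> 0 < peval F u) ->
  sphere_qm g (peval F).
Proof.
elim: Z F => [|z Z IH] F; first by move=> _ _ pos; apply: (sphere_qm_pos N_gt0 gN) => u fu; apply: pos.
move=> /= /andP[zZ uZ] HZ pos.
have [fz Fz Lz] := HZ z (mem_head _ _); have [z1 _] := fz.
have {}HZ x : x \in Z -> [/\ sphere_feasible g x, peval F x = 0 & local_growth g N F x].
  by move=> xZ; apply: HZ; rewrite inE xZ orbT.
have F0 u : sphere_feasible g u -> 0 <= peval F u.
  move=> fu; have [uz|uz] := boolP (u \in z :: Z); last exact/ltW/pos.
  by move: uz; rewrite inE => /orP[/eqP ->|/HZ[_ -> _]]; rewrite ?Fz.
have [x xZ|t [C [C0 Ht]]] := @peak_poly R n z Z z1.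
  have [[x1 _] _ _] := HZ x xZ; split=> //.
  by apply: contraNneq zZ => <-.
pose p := t ^+ 2; pose b := (1 - p) * (1 - 2%:R *: p); pose b' := p * (2%:R *: p - 1).
have pE u : peval p u = peval t u ^+ 2 by rewrite pevalXn.
have bE u : peval b u = (1 - peval p u) * (1 - 2 * peval p u) by rewrite !pevalE.
have b'E u : peval b' u = peval p u * (2 * peval p u - 1) by rewrite !pevalE.
have p0 u : 0 <= peval p u by rewrite pE sqr_ge0.
have pbound u : dot u u = 1 -> [/\ dot (u - z) (u - z) / 4 <= 1 - peval p u,
    1 - peval p u <= 2 * C * dot (u - z) (u - z) &
    forall x, x \in Z -> peval p u <= C * dot (u - x) (u - x)].
  move=> u1; have [h1 h2 h3] := Ht u u1; have dz := dot_ge0 (u - z).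
  rewrite pE; split=> //.
    have : peval t u ^+ 2 <= `|peval t u|.
      rewrite -real_normK ?num_real // expr2 ler_piMr //; lra.
    by move=> ?; lra.
  move: h1; rewrite ler_norml => /andP[h4 h5].
  by nra.
have bbound u : dot u u = 1 -> `|peval b u| <= 2 * C * dot (u - z) (u - z).
  move=> u1; have [h1 h2 _] := pbound u u1; have dz := dot_ge0 (u - z).
  have := p0 u; rewrite bE => pu; rewrite ler_norml; apply/andP; split; nra.
have b'bound u x : dot u u = 1 -> x \in Z -> `|peval b' u| <= C * dot (u - x) (u - x).
  move=> u1 xZ; have [h1 _ h3] := pbound u u1; have dz := dot_ge0 (u - z).
  have := h3 x xZ; have := p0 u; rewrite b'E => *.
  rewrite ler_norml; apply/andP; split; nra.
have pz : peval p z = 1.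
  have [h1 h2 _] := pbound z z1; move: h1 h2; rewrite subrr dot0l !mulr0 mul0r => *.
  by lra.
have px x : x \in Z -> peval p x = 0.
  move=> xZ; have [[x1 _] _ _] := HZ x xZ; have [_ _ /(_ x xZ)] := pbound x x1.
  by rewrite subrr dot0l mulr0 => ?; apply: le_anti; rewrite p0 andbT.
have posb x : sphere_feasible g x -> x != z -> x \notin Z -> 0 < peval F x.
  by move=> fx xz xZ; apply: pos; rewrite // inE negb_or xz.
have [e1 e10 H1] := local_growth_add Lz bbound.
have [x fx|e2 e20 H2] := @pos_add_uniform R n m g N F b [:: z] F0.
  have [xz|xz] := eqVneq x z.
    by apply: Or33; rewrite xz mem_head; split=> //; exists (2 * C).
  have [xZ|xZ] := boolP (x \in Z); last by apply: Or31; apply: posb.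
  by apply: Or32; rewrite bE px // mulr0 subr0 mulr1.
have [x fx|e3 e30 H3] := @pos_add_uniform R n m g N F b' Z F0.
  have [xZ|xZ] := boolP (x \in Z).
    have [_ _ Lx] := HZ x xZ.
    by apply: Or33; split=> //; exists C => u u1; apply: b'bound.
  have [xz|xz] := eqVneq x z; last by apply: Or31; apply: posb.
  by apply: Or32; rewrite b'E xz pz; lra.
have [e4 e40 H4] : exists2 e4 : R, 0 < e4 & forall e, 0 < e <= e4 ->
    forall x, x \in Z -> local_growth g N (F + e *: b') x.
  have : {subset Z <= Z} by [].
  elim: {1 3}Z => [|x s IHs] sZ; first by exists 1.
  have [|e4 e40 H4] := IHs; first by move=> y ys; apply: sZ; rewrite inE ys orbT.
  have xZ := sZ x (mem_head _ _); have [_ _ Lx] := HZ x xZ.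
  have [e5 e50 H5] := local_growth_add Lx (fun u hu => b'bound u x hu xZ).
  exists (Num.min e4 e5); first by rewrite lt_min e40.
  move=> e; rewrite le_min => /and3P[he h4 h5] y; rewrite inE => /orP[/eqP ->|].
    by apply: H5; apply/andP.
  by apply: H4; apply/andP.
pose e := Num.min (Num.min e1 e2) (Num.min e3 e4).
have e0 : 0 < e by rewrite !lt_min e10 e20 e30.
have ee1 : 0 < e <= e1 by rewrite e0 /e !ge_min lexx.
have ee2 : 0 < e <= e2 by rewrite e0 /e !ge_min lexx !orbT.
have ee3 : 0 < e <= e3 by rewrite e0 /e !ge_min lexx !orbT.
have ee4 : 0 < e <= e4 by rewrite e0 /e !ge_min lexx !orbT.
have Q1 : sphere_qm g (peval (F + e *: b)).
  apply: (sphere_qm_single N_gt0 gN z1) (H1 e ee1) _ => [|u fu uz].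
    by rewrite pevalD pevalZ bE pz Fz subrr mul0r mulr0 addr0.
  by apply: (H2 e ee2) => //; rewrite inE.
have Q2 : sphere_qm g (peval (F + e *: b')).
  apply: IH => // [x xZ|u fu uZ']; last exact: (H3 e ee3).
  have [fx Fx _] := HZ x xZ; split=> //; last exact: H4.
  by rewrite pevalD pevalZ b'E px // Fx mul0r mulr0 addr0.
have S1 : sphere_sos (peval p).
  by apply: sphere_sos_eq (sphere_sos_sqr t) => u _; rewrite pE.
(* The weight [1 - p] is itself a polynomial whose only zero on the sphere is [z], with growth at
   rate 1/4, so the one-zero theorem applies to it. *)
have S2 : sphere_sos (peval (1 - p)).
  have q0 : (0 : R) < 4^-1 by rewrite invr_gt0.
  apply: (sphere_sos_single z1 _ q0 ltr01) => [|u u1 _|u u1 uz].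
  - by rewrite pevalB peval1 pz subrr.
  - by rewrite pevalB peval1 mulrC; have [] := pbound u u1.
  - have [h _ _] := pbound u u1; rewrite pevalB peval1.
    by apply: lt_le_trans h; rewrite divr_gt0 // dotB_gt0.
apply: sphere_qm_eq (sphere_qmD (sphere_qm_sosM S1 Q1) (sphere_qm_sosM S2 Q2)) => u _.
by rewrite pevalB peval1 !pevalD !pevalZ bE b'E; ring.
Qed.

End FiniteZeros.

(** * First and second order conditions *)

Section LinearAlgebra.
Variables (R : realType) (n : nat) (I : finType) (A : {set I}) (G : I -> 'rV[R]_n).

Let M : 'M[R]_(#|A|, n) := \matrix_(a < #|A|) G (enum_val a).

Let mulM (w : 'cV[R]_n) i : i \in A -> exists a, i = enum_val a /\ (M *m w) a 0 = dot w^T (G i).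
Proof.
move=> iA; exists (enum_rank_in iA i); rewrite enum_rankK_in //; split=> //.
rewrite mxE; apply: eq_bigr => b _.
by rewrite !mxE enum_rankK_in // mulrC.
Qed.

Lemma free_dual_solve : free [seq G i | i <- enum A] ->
  forall c : I -> R, exists v, forall i, i \in A -> dot v (G i) = c i.
Proof.
move=> frA c; have /row_freeP[B MB] : row_free M.
  apply: inj_row_free => v vM; apply/rowP => a; rewrite mxE.
  have := freeP (X := map_tuple G (enum_tuple A)) frA (fun a => v 0 a) _ a; apply.
  rewrite -[RHS]vM; apply/rowP => b; rewrite summxE mxE; apply: eq_bigr => d _.
  by rewrite !mxE (nth_map (enum_val d)) -?cardE // -enum_val_nth.
exists (B *m \col_a c (enum_val a))^T => i /(mulM (B *m \col_a c (enum_val a))).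
by move=> [a [-> <-]]; rewrite mulmxA MB mul1mx mxE.
Qed.

(** Fredholm alternative; a column of the cokernel matrix separates. *)
Lemma in_span_or_separated (w : 'rV[R]_n) :
  (exists lam : I -> R, w = \sum_(i in A) lam i *: G i) \/
  exists2 v, dot v w != 0 & forall i, i \in A -> dot v (G i) = 0.
Proof.
have [/submxP[D wD]|] := boolP (w <= M)%MS.
  left; exists (fun i => \sum_(a | enum_val a == i) D 0 a).
  rewrite wD; apply/rowP => b; rewrite mxE summxE.
  rewrite (partition_big (fun a => enum_val a) (mem A)) /= => [|a _]; last exact: enum_valP.
  apply: eq_bigr => i iA; rewrite mxE mulr_suml; apply: eq_bigr => a /eqP ai.
  by rewrite !mxE ai.
rewrite submxE => /eqP/rowP/boolp.existsNP[j wj].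
right; exists (col j (cokermx M))^T.
  apply/eqP; apply: contra_not wj => wj; rewrite [RHS]mxE -wj mxE.
  by apply: eq_bigr => b _; rewrite !mxE mulrC.
move=> i /(mulM (col j (cokermx M)))[a [_ <-]].
by rewrite colE mulmxA mulmx_coker mul0mx mxE.
Qed.
End LinearAlgebra.

(** * Homogeneity and second-order growth *)

Section Criticality.
Variables (R : realType) (n : nat).
Implicit Types (p q : {mpoly R[n]}) (u v x z : 'rV[R]_n).

Lemma small_forall (I : finType) (P : I -> R -> Prop) :
  (forall i, exists2 r : R, 0 < r & forall t, 0 < t < r -> P i t) ->
  exists2 r : R, 0 < r & forall t, 0 < t < r -> forall i, P i t.
Proof.
move=> H; suff [r r0 Hr] : exists2 r : R, 0 < r & forall t, 0 < t < r ->
    forall i, i \in enum I -> P i t.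
  by exists r => // t /Hr Pt i; apply: Pt; rewrite mem_enum.
elim: (enum I) => [|i s [r r0 Hr]]; first by exists 1.
have [r' r'0 Hr'] := H i; exists (Num.min r r'); first by rewrite lt_min r0.
move=> t /andP[t0]; rewrite lt_min => /andP[tr tr'] j; rewrite inE => /orP[/eqP ->|].
  by apply: Hr'; rewrite t0.
by apply: Hr; rewrite t0.
Qed.

Lemma poly_pos_ray p z v : 0 < peval p z ->
  exists2 r : R, 0 < r & forall t, 0 < t < r -> 0 < peval p (z + t *: v).
Proof.
move=> /poly_pos_near[r r0 Hr]; pose V := 1 + \sum_i `|v 0 i|.
have V0 : 0 < V by rewrite ltr_wpDr // sumr_ge0.
exists (r / V); first exact: divr_gt0.
move=> t /andP[t0]; rewrite ltr_pdivlMr // => tV; apply: Hr => i.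
rewrite !mxE addrAC subrr add0r normrM (gtr0_norm t0); apply: le_lt_trans tV.
rewrite ler_wpM2l ?(ltW t0) // /V (bigD1 i) //= addrCA lerDl addr_ge0 //.
exact: sumr_ge0.
Qed.

Lemma peval_homog p d c u : p \is d.-homog -> peval p (c *: u) = c ^+ d * peval p u.
Proof.
move=> ph; rewrite /peval !mevalE mulr_sumr.
rewrite [LHS]big_seq [RHS]big_seq; apply: eq_bigr => mon /(dhomog_mf ph) md.
rewrite mulrCA; congr (_ * _).
have {1}<- : mdeg mon = d by [].
rewrite mdegE -prodrXr -big_split; apply: eq_bigr => i _.
by rewrite mxE exprMn.
Qed.

(** Euler's relation at a zero: [p] vanishes along the ray through [z], so neither [p] nor [- p] can
    increase there. *)
Lemma homog_crit p d z : p \is d.-homog -> peval p z = 0 -> peval (dir z p) z = 0.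
Proof.
move=> ph pz.
have H q : q \is d.-homog -> peval q z = 0 -> ~ 0 < peval (dir z q) z.
  move=> qh qz /first_order_pos[r r0 /(_ (r / 2))].
  rewrite -{2}(scale1r z) -scalerDl (peval_homog _ _ qh) qz mulr0 ltxx => F.
  by suff: false by []; apply: F; lra.
case: (ltgtP (peval (dir z p) z) 0) => // D.
  case: (H (- p)); rewrite ?dhomogN ?pevalN ?pz ?oppr0 //.
  by rewrite dirN pevalN oppr_gt0.
by case: (H p).
Qed.

(** Finsler with [B = z z^T] turns positivity on the tangent space into definiteness up to a
    multiple of [(z . (u - z))^2]. On the sphere this equals [|u - z|^4 / 4] and is negligible near
    [z]. *)
Lemma growth_of_Hessian p z : dot z z = 1 -> peval p z = 0 ->
  (forall v, peval (dir v p) z = 0) ->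
  (forall v, v != 0 -> dot v z = 0 -> 0 < peval (dir v (dir v p)) z) ->
  exists c r, [/\ 0 < c, 0 < r &
    forall u, dot u u = 1 -> near z r u -> c * dot (u - z) (u - z) <= peval p u].
Proof.
move=> z1 pz Dp Hp; have [T [HT hT]] := Taylor2 z p.
have [v|v v0|C [mu [C0 mu0 H]]] := @Finsler_const R n
    (fun a b => peval (T a b) z) (fun a b => z 0 a * z 0 b).
- by rewrite qform_rank1 sqr_ge0.
- rewrite qform_rank1 => /eqP; rewrite sqrf_eq0 dotC => /eqP vz.
  by rewrite hT divr_gt0 // Hp.
have mu2 : 0 < mu / 2 by lra.
have [r r0 Hr] := qform_cont T z mu2.
have C1 : 0 < C + 1 by lra.
have [s s0 Hs] := @dot_near R n (mu / (C + 1)) (divr_gt0 mu0 C1).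
exists (mu / 4), (Num.min r s); split; [lra | by rewrite lt_min r0 |].
move=> u u1 zu; rewrite HT pz Dp !add0r.
have := Hr u (near_le _ zu) (u - z); have := Hs z u (near_le _ zu).
rewrite !ge_min !lexx orbT ltr_pdivlMr // => /(_ isT) h1 /(_ isT).
rewrite ler_norml => /andP[h2 _]; have := H (u - z); rewrite qform_rank1.
have -> : dot z (u - z) = - (dot (u - z) (u - z) / 2).
  by rewrite !dotE (dotC u z) z1 u1; field.
move: h1 h2 (dot_ge0 (u - z)); set D := dot _ _ => h1 h2 D0 h3.
have h4 : D * (D * (C + 1)) <= D * mu by rewrite ler_wpM2l // ltW.
have h5 : 0 <= D * D by rewrite mulr_ge0.
by have h6 : 0 <= D * mu; [rewrite mulr_ge0 // ltW | lra].
Qed.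

Lemma peval_dirX v p k z : peval p z = 1 ->
  peval (p ^+ k) z = 1 /\ peval (dir v (p ^+ k)) z = k%:R * peval (dir v p) z.
Proof.
move=> pz; split; first by rewrite pevalXn pz expr1n.
elim: k => [|k IH]; first by rewrite expr0 dir1 peval0 mul0r.
by rewrite exprS dirM pevalD !pevalM IH pevalXn pz expr1n -natr1; ring.
Qed.

End Criticality.

(** * Multipliers and growth at the zeros of the form *)

Section ZerosOfForms.
Variables (R : realType) (n m : nat) (f : {mpoly R[n]}) (g : m.-tuple {mpoly R[n]}).
Hypothesis f_form : even_form f.
Hypothesis g_form : forall j : 'I_m, even_form (tnth g j).
Hypothesis f_ge0 : forall u : 'rV[R]_n, basic_closed_set g u -> 0 <= peval f u.
Implicit Types (u v x z : 'rV[R]_n).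

Let h := sphere_constraints g.

Lemma minimizer_of_zero z : sphere_feasible g z -> peval f z = 0 -> minimizer f h z.
Proof.
move=> [z1 zg] fz; split; first split=> [[]|//].
  by rewrite /h /= pevalB peval1 peval_sqnorm z1 subrr.
by move=> v [_ vg]; rewrite fz f_ge0.
Qed.

(* [f >= 0] on the whole cone, so a direction strictly feasible for the active
   [g_j] alone cannot decrease [f], and the sphere plays no role. *)
Lemma strictly_feasible_direction z v :
  basic_closed_set g z -> peval f z = 0 ->
  (forall j, peval (tnth g j) z = 0 -> 0 < peval (dir v (tnth g j)) z) ->
  0 <= peval (dir v f) z.
Proof.
move=> zg fz Hv; rewrite leNgt; apply/negP => Df.
have [|r r0 Hr] := @first_order_pos R n (- f) z v; first by rewrite dirN pevalN oppr_gt0.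
have [j|s s0 Hs] := @small_forall R 'I_m (fun j t => 0 <= peval (tnth g j) (z + t *: v)).
  have [gz|gz] := eqVneq (peval (tnth g j) z) 0.
    have [s s0 Hs] := first_order_pos (Hv j gz); exists s => // t /Hs.
    by rewrite gz => /ltW.
  have [|s s0 Hs] := @poly_pos_ray R n (tnth g j) z v; first by rewrite lt0r gz zg.
  by exists s => // t /Hs /ltW.
have rs0 : 0 < Num.min r s by rewrite lt_min r0.
pose t := Num.min r s / 2.
have t0 : 0 < t by rewrite divr_gt0.
have tr : t < r by apply: (@lt_le_trans _ _ (Num.min r s)); [rewrite /t; lra | rewrite ge_min lexx].
have ts : t < s by apply: (@lt_le_trans _ _ (Num.min r s)); [rewrite /t; lra | rewrite ge_min lexx orbT].
have := Hr t; rewrite t0 tr !pevalN fz oppr0 oppr_gt0 => /(_ isT).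
by rewrite ltNge f_ge0 // => j; apply: Hs; rewrite t0.
Qed.

Lemma dir_sphere_constraint v : dir v (sqnorm R n - 1) = 2 *: \sum_i v 0 i *: 'X_i.
Proof.
rewrite dirB dir1 subr0 dir_sum scaler_sumr.
apply: eq_bigr => i _; rewrite expr2 dirM dirXU ['X_i * _]mulrC -mulr2n mul_mpolyC.
by rewrite scaler_nat.
Qed.

Lemma gradient_sphere_constraint v u : dot v (gradient (sqnorm R n - 1) u) = 2 * dot v u.
Proof.
rewrite -peval_dir dir_sphere_constraint pevalZ peval_sum; congr (_ * _).
by apply: eq_bigr => i _; rewrite !pevalE.
Qed.

Lemma multipliers_exist z : sphere_feasible g z -> peval f z = 0 -> LICQC h z ->
  exists lam, [/\ multipliers f h z lam, lam (inl tt) = 0 &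
    forall j, peval (tnth g j) z != 0 -> lam (inr j) = 0].
Proof.
move=> [z1 zg] fz licq.
pose G i := gradient (h i) z; pose A := active h z.
have dirG v j : peval (dir v (tnth g j)) z = dot v (G (inr j)) by rewrite peval_dir.
have inA j : (inr j \in A) = (peval (tnth g j) z == 0) by rewrite inE.
have inlA : inl tt \in A by rewrite inE /h /= pevalB peval1 peval_sqnorm z1 subrr.
have solve := free_dual_solve (G := G) licq.
have [[la fE]|[w wf wA]] := in_span_or_separated A G (gradient f z); last first.
  have [v Hv] := solve (fun=> 1).
  (* Adding [tau *: w] leaves the derivatives of the active constraints at 1 and brings that of [f]
     to -1. *)
  pose tau := - (1 + dot v (gradient f z)) / dot w (gradient f z).
  have : 0 <= peval (dir (v + tau *: w) f) z.
    apply: strictly_feasible_direction => // j gz.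
    rewrite dirG dotDl dotZl; have jA : inr j \in A by rewrite inA gz.
    by rewrite Hv // wA // mulr0 addr0.
  rewrite peval_dir dotDl dotZl /tau divfK //.
  by move=> ?; exfalso; lra.
pose lam i := if i \in A then la i else 0.
have dotf v : dot v (gradient f z) = \sum_(i in A) la i * dot v (G i).
  rewrite fE; elim/big_rec2: _ => [|i y1 y2 _ <-]; first by rewrite dotC dot0l.
  by rewrite dotDr dotZr.
have lam_inl : lam (inl tt) = 0.
  (* Pairing with [z] kills [f] and every active [g_j] by Euler's relation, leaving only the sphere
     term. *)
  rewrite /lam inlA; have := dotf z.
  rewrite (bigD1 (inl tt)) //= big1 => [|i /andP[iA ni]].
    rewrite -peval_dir addr0; have [d _ fh] := f_form.
    rewrite (homog_crit fh) // gradient_sphere_constraint z1 => /esym/eqP.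
    by rewrite mulr1 mulf_eq0 pnatr_eq0 orbF => /eqP.
  case: i iA ni => [[]|j] //; rewrite inA => /eqP gz _.
  by have [d _ gh] := g_form j; rewrite -dirG (homog_crit gh) ?mulr0.
exists lam; split=> //; last by move=> j gz; rewrite /lam inA (negPf gz).
split=> [|j|j].
- rewrite fE big_mkcond /=; apply: eq_bigr => i _; rewrite /lam.
  by case: ifP => // _; rewrite scale0r.
- rewrite /lam inA; case: eqP => // gz.
  have jA : inr j \in A by rewrite inA gz.
  rewrite leNgt; apply/negP => laj.
  pose S := \sum_(i in A | i != inr j) `|la i|.
  have S0 : 0 <= S by apply: sumr_ge0.
  have S1 : 0 < 2 * (S + 1) by lra.
  (* Derivative 1 for [g_j] and [de] for the other active constraints is strictly feasible; the
     others then offset less than half of the negative [la (inr j)]. *)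
  pose de := - la (inr j) / (2 * (S + 1)).
  have de0 : 0 < de by rewrite divr_gt0 // oppr_gt0.
  have deS : de * (2 * (S + 1)) = - la (inr j) by rewrite divfK // gt_eqF.
  have [v Hv] := solve (fun i => if i == inr j then 1 else de).
  have : 0 <= peval (dir v f) z.
    apply: strictly_feasible_direction => // j' gz'.
    by rewrite dirG Hv ?inA ?gz' //; case: ifP.
  rewrite peval_dir dotf (bigD1 (inr j)) //= Hv // eqxx mulr1.
  have : \sum_(i in A | i != inr j) la i * dot v (G i) <= S * de.
    rewrite mulr_suml; apply: ler_sum => i /andP[iA ij].
    by rewrite Hv // (negPf ij) ler_wpM2r ?ler_norm // ltW.
  move=> h1 h2; lra.
- rewrite /lam /= inA; case: eqP => [->|_]; first by rewrite mulr0.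
  by rewrite mul0r.
Qed.

(** With weights [lambda_j] at [z], the multiplier equation cancels the gradient, and the Hessian
    becomes that of the Lagrangian plus [(4 k / N) \sum_j lambda_j (dg_j)^2]. By SCC this sum
    vanishes only where all active [dg_j] do; on such tangent vectors SOSC applies, and Finsler
    provides [k]. *)
Lemma zero_local_growth N z : 0 < N -> sphere_feasible g z -> peval f z = 0 ->
  LICQC h z -> SCC f h z -> SOSC f h z -> local_growth g N f z.
Proof.
move=> N0 fz f0 licq scc sosc; have [z1 zg] := fz.
have [lam [lamP lam0 lamI]] := multipliers_exist fz f0 licq.
have [gradE _ _] := lamP.
have lam_pos j : peval (tnth g j) z = 0 -> 0 < lam (inr j).
  by move=> gz; have := scc lam lamP j; rewrite /h /= gz addr0.
pose gj j := tnth g j.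
pose dg j v := peval (dir v (gj j)) z.
have sumE (F : unit + 'I_m -> R) : \sum_i F i = F (inl tt) + \sum_j F (inr j).
  by rewrite big_sumType (big_pred1 tt) //; case.
have lagE v : peval (dir v (dir v (lagrangian f h lam))) z =
    peval (dir v (dir v f)) z - \sum_j lam (inr j) * peval (dir v (dir v (gj j))) z.
  rewrite !dirB_sum pevalB; congr (_ - _); rewrite peval_sum sumE.
  rewrite lam0 !dirZ pevalZ mul0r add0r; apply: eq_bigr => j _.
  by rewrite !dirZ pevalZ.
have df v : peval (dir v f) z = \sum_j lam (inr j) * dg j v.
  rewrite peval_dir gradE; transitivity (\sum_i lam i * dot v (gradient (h i) z)).
    elim/big_rec2: _ => [|i y1 y2 _ <-]; first by rewrite dotC dot0l.
    by rewrite dotDr dotZr.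
  rewrite sumE lam0 mul0r add0r; apply: eq_bigr => j _.
  by rewrite /dg peval_dir.
have lam_ge0 j : 0 <= lam (inr j).
  have [gz|gz] := eqVneq (peval (gj j) z) 0; first exact/ltW/lam_pos.
  by rewrite lamI.
pose L := lagrangian f h lam.
have [v|v v0|C [mu [C0 mu0 HC]]] := @Finsler_const R n
    (fun a b => peval L^`M(a)^`M(b) z)
    (fun a b => \sum_j lam (inr j) * (gradient (gj j) z 0 a * gradient (gj j) z 0 b) + z 0 a * z 0 b).
- rewrite qformD qform_rank1 qform_sum addr_ge0 ?sqr_ge0 //.
  by apply: sumr_ge0 => j _; rewrite qform_scale qform_rank1 mulr_ge0 ?sqr_ge0.
- rewrite qformD qform_rank1 qform_sum.
  have S0 : 0 <= \sum_j qform (fun a b => lam (inr j) * (gradient (gj j) z 0 a * gradient (gj j) z 0 b)) v.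
    by apply: sumr_ge0 => j _; rewrite qform_scale qform_rank1 mulr_ge0 ?sqr_ge0.
  move=> /eqP; rewrite paddr_eq0 ?sqr_ge0 // psumr_eq0 => [|j _]; last first.
    by rewrite qform_scale qform_rank1 mulr_ge0 ?sqr_ge0.
  rewrite sqrf_eq0 => /andP[/allP Hj /eqP zv].
  rewrite -peval_dir2 -hessian_dir2; apply: (sosc lam lamP) => // i.
  rewrite inE => iA; apply/matrixP => a b; rewrite !ord1 !mxE.
  transitivity (dot v (gradient (h i) z)).
    by apply: eq_bigr => c _; rewrite !mxE mulrC.
  case: i iA => [[] _|j gz].
    by rewrite gradient_sphere_constraint dotC zv mulr0.
  have := Hj j (mem_index_enum j); rewrite qform_scale qform_rank1.
  by rewrite mulf_eq0 gt_eqF ?lam_pos ?(eqP gz) //= sqrf_eq0 dotC => /eqP.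
have {}HC v : dot v z = 0 -> mu * dot v v <=
    peval (dir v (dir v L)) z + C * \sum_j lam (inr j) * dg j v ^+ 2.
  move=> vz; apply: le_trans (HC v) _; rewrite -peval_dir2 lerD2l qformD qform_rank1.
  rewrite dotC vz expr0n addr0 qform_sum ler_wpM2l //; apply: ler_sum => j _.
  by rewrite qform_scale qform_rank1 /dg peval_dir dotC.
have N4 : 0 < 4 / N by rewrite divr_gt0.
have [k0 Hk] := archi_mul C N4.
have {Hk} Hk := Hk k0 (leqnn _).
pose w : {mpoly R[n]} := \sum_i ('X_i - (z 0 i)%:MP) ^+ 2.
have wE u : peval w u = dot (u - z) (u - z).
  by rewrite peval_sum; apply: eq_bigr => i _; rewrite !pevalE !mxE expr2.
have wz : peval w z = 0 by rewrite wE subrr dot0l.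
have dw v : peval (dir v w) z = 0.
  rewrite dir_sum peval_sum big1 // => i _.
  by rewrite expr2 dirM pevalD !pevalM !pevalE subrr mul0r mulr0 addr0.
(* An inactive constraint gets the weight [|x - z|^2]: nonzero off [z], and flat enough at [z] to
   leave the value, gradient and Hessian unchanged. *)
pose a j := if peval (gj j) z == 0 then (Num.sqrt (lam (inr j)))%:MP else w.
pose b j := 1 - N^-1 *: gj j.
pose q j := a j * b j ^+ k0.
have bz j : peval (gj j) z = 0 -> peval (b j) z = 1.
  by move=> gz; rewrite /b !pevalE gz mulr0 subr0.
have db j v : peval (dir v (b j)) z = - (dg j v / N).
  by rewrite /b dirB dirZ dir1 sub0r pevalN pevalZ mulrC.
have qz j : peval (gj j) z = 0 -> peval (q j) z ^+ 2 = lam (inr j).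
  move=> gz; rewrite /q /a gz eqxx pevalM pevalC pevalXn bz // expr1n mulr1.
  by rewrite sqr_sqrtr.
have qz0 j : peval (gj j) z != 0 -> peval (q j) z = 0.
  by move=> gz; rewrite /q /a (negPf gz) pevalM wz mul0r.
have dq j v : peval (dir v (q j)) z = - (peval (q j) z * (k0%:R * (dg j v / N))).
  rewrite /q /a; have [gz|gz] := eqVneq (peval (gj j) z) 0.
    have [b1 b2] := @peval_dirX R n v (b j) k0 z (bz j gz).
    by rewrite dirM dirC pevalD !pevalM peval0 b1 b2 db pevalC; ring.
  by rewrite dirM pevalD !pevalM dw wz !mul0r addr0 oppr0.
pose p := pert g N a k0 f.
have dp v : dir v p = dir v f - \sum_j dir v (q j ^+ 2 * gj j).
  exact: dirB_sum.
have p0 : peval p z = 0.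
  rewrite /p /pert pevalB f0 peval_sum big1 ?subrr // => j _.
  rewrite pevalM pevalXn -/(q j) -/(gj j).
  by have [->|gz] := eqVneq (peval (gj j) z) 0; rewrite ?mulr0 ?qz0 ?expr0n ?mul0r.
have Dp v : peval (dir v p) z = 0.
  rewrite dp pevalB df peval_sum; apply/eqP; rewrite subr_eq0; apply/eqP.
  apply: eq_bigr => j _.
  rewrite peval_dir_sqrM -/(dg j v).
  have [gz|gz] := eqVneq (peval (gj j) z) 0; first by rewrite qz // gz mulr0 add0r.
  by rewrite lamI // qz0 //; ring.
have D2p v : peval (dir v (dir v p)) z =
    peval (dir v (dir v L)) z + k0%:R * (4 / N) * \sum_j lam (inr j) * dg j v ^+ 2.
  rewrite dp dirB_sum pevalB lagE -addrA; congr (_ + _); rewrite peval_sum.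
  rewrite -sumrN mulr_sumr -sumrN -big_split; apply: eq_bigr => j _ /=.
  rewrite peval_dir2_sqrM -/(dg j v).
  have [gz|gz] := eqVneq (peval (gj j) z) 0; last first.
    by rewrite lamI // dq !qz0 //; ring.
  rewrite -(qz j gz) dq gz; field.
  by rewrite gt_eqF.
have [v v0 vz|c [r [c0 r0 grow]]] := growth_of_Hessian z1 p0 Dp.
  rewrite D2p; have := HC v vz.
  have S0 : 0 <= \sum_j lam (inr j) * dg j v ^+ 2.
    by apply: sumr_ge0 => j _; rewrite mulr_ge0 ?sqr_ge0.
  have := ler_wpM2r S0 (ltW Hk); have : 0 < mu * dot v v by rewrite mulr_gt0 // dot_gt0.
  by move=> *; lra.
exists a, k0, c, r; split=> // [j u u1 uz|j]; rewrite /a.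
  case: (peval (gj j) z =P 0) => [gz|_]; first by rewrite pevalC gt_eqF // sqrtr_gt0 lam_pos.
  by rewrite wE gt_eqF // dotB_gt0.
by case: (peval (gj j) z =P 0) => [gz|_]; rewrite ?gz ?mulr0 // wz mul0r.
Qed.

Lemma sphere_qm_form :
  (forall u, minimizer f h u -> [/\ LICQC h u, SCC f h u & SOSC f h u]) ->
  sphere_qm g (peval f).
Proof.
move=> opt; have [N N0 gN] := constraint_bound g.
have loc z : sphere_feasible g z -> peval f z = 0 -> local_growth g N f z.
  move=> fz f0; have [licq scc sosc] := opt z (minimizer_of_zero fz f0).
  exact: zero_local_growth.
pose P (X : 'rV[R]_n -> Prop) := exists s : seq 'rV[R]_n,
  forall u, X u -> sphere_feasible g u -> peval f u = 0 -> u \in s.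
have [||||s Hs] := @compact_ind R n (sphere_feasible g) 1 P
    (@sphere_feasible_box R n m g) (@sphere_feasible_closed R n m g).
- by move=> A B AB [s Hs]; exists s => u /AB; apply: Hs.
- move=> A B [s Hs] [t Ht]; exists (s ++ t) => u [Au|Bu] fu u0; rewrite mem_cat.
    by rewrite Hs.
  by rewrite Ht ?orbT.
- by exists [::].
- move=> x fx; have [x0|x0] := eqVneq (peval f x) 0.
    have [c [r [c0 r0 Hr]]] := local_growth_le (loc x fx x0).
    exists r => //; exists [:: x] => u [_ xu] fu u0; rewrite inE.
    apply: contraTT (Hr u fu xu) => ux; rewrite u0 -ltNge mulr_gt0 //.
    by rewrite dotB_gt0.
  have fx0 : 0 < peval f x by rewrite lt0r x0 f_ge0 //; case: fx.
  have [r r0 Hr] := poly_pos_near fx0.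
  by exists r => //; exists [::] => u [_ /Hr] + _ u0; rewrite u0 ltxx.
(* The list [s] contains all zeros but possibly other points, which this test filters out. *)
pose zero u := [&& dot u u == 1, [forall j, 0 <= peval (tnth g j) u] & peval f u == 0].
have zeroP u : reflect (sphere_feasible g u /\ peval f u = 0) (zero u).
  apply: (iffP and3P) => [[/eqP u1 /forallP ug /eqP u0]|[[u1 ug] u0]] //.
  by split; [rewrite u1 | apply/forallP | rewrite u0].
apply: (sphere_qm_finite_zeros N0 gN (Z := undup (filter zero s))).
- exact: undup_uniq.
- move=> z; rewrite mem_undup mem_filter => /andP[/zeroP[fz f0] _].
  by split=> //; apply: loc.
- move=> u fu; rewrite mem_undup mem_filter negb_and => uZ.
  rewrite lt0r f_ge0 ?andbT; last by case: fu.
  apply: contraTneq uZ => u0; rewrite negb_or !negbK Hs // andbT.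
  by apply/zeroP.
Qed.

End ZerosOfForms.

(** * Homogenization *)

Section Homogenization.
Variables (R : realType) (n : nat).
Implicit Types (p q : {mpoly R[n]}) (u v x z : 'rV[R]_n).

Lemma sosD p q : sos p -> sos q -> sos (p + q).
Proof. by move=> [s ->] [t ->]; exists (s ++ t); rewrite big_cat. Qed.

Lemma sosM p q : sos p -> sos q -> sos (p * q).
Proof.
move=> [s ->] [t ->]; exists [seq a * b | a <- s, b <- t].
rewrite big_allpairs_dep mulr_suml; apply: eq_bigr => a _.
by rewrite mulr_sumr; apply: eq_bigr => b _; rewrite exprMn.
Qed.

Lemma sos_sqr p : sos (p ^+ 2).
Proof. by exists [:: p]; rewrite big_seq1. Qed.

Lemma sos_sqnormX k : sos (sqnorm R n ^+ k).
Proof.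
elim: k => [|k IH]; first by rewrite expr0 -(expr1n _ 2); apply: sos_sqr.
rewrite exprS; apply: sosM => //.
by exists [seq 'X_i | i <- index_enum 'I_n]; rewrite big_map.
Qed.

(* [A] collects the terms of even degree, [B] those of odd degree. *)
Lemma homogenize_parity q : exists E0, forall E, (E0 <= E)%N -> exists A B : {mpoly R[n]},
  (forall x r, r != 0 -> r ^+ 2 = dot x x ->
     r ^+ (2 * E) * peval q (r^-1 *: x) = peval A x + r * peval B x) /\
  (forall x, peval A (- x) = peval A x /\ peval B (- x) = - peval B x).
Proof.
have sqN x k : peval (sqnorm R n ^+ k) (- x) = peval (sqnorm R n ^+ k) x.
  by rewrite !pevalXn !peval_sqnorm dotNl dotNr opprK.
elim/mpoly_ring_ind: q => [c|i|p q [E1 H1] [E2 H2]|p q [E1 H1] [E2 H2]].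
- exists 0%N => E _; exists (c *: sqnorm R n ^+ E), 0; split=> [x r r0 rx|x].
    by rewrite pevalC peval0 mulr0 addr0 pevalZ pevalXn peval_sqnorm -rx exprM mulrC.
  by rewrite !pevalZ sqN !peval0 oppr0.
- exists 1%N => [] [|E] // _; exists 0, (sqnorm R n ^+ E * 'X_i); split=> [x r r0 rx|x].
    rewrite pevalXU peval0 add0r pevalM pevalXU pevalXn peval_sqnorm -rx exprM !mxE exprS.
    by field.
  by rewrite !pevalM sqN !pevalXU !peval0 mxE mulrN.
- exists (maxn E1 E2) => E; rewrite geq_max => /andP[/H1[A [B [AB par]]] /H2[A' [B' [AB' par']]]].
  exists (A + A'), (B + B'); split=> [x r r0 rx|x].
    by rewrite pevalD mulrDr AB // AB' // !pevalD; ring.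
  have [a b] := par x; have [a' b'] := par' x.
  by rewrite !pevalD a b a' b' opprD.
- exists (E1 + E2)%N => E EE; have [A [B [AB par]]] := H1 _ (leqnn _).
  have [|A' [B' [AB' par']]] := H2 (E - E1)%N; first by rewrite leq_subRL ?(leq_trans (leq_addr _ _) EE).
  exists (A * A' + sqnorm R n * (B * B')), (A * B' + A' * B); split=> [x r r0 rx|x].
    have -> : (2 * E = 2 * E1 + 2 * (E - E1))%N by have := leq_trans (leq_addr _ _) EE; lia.
    rewrite exprD pevalM mulrACA AB // AB' // !(pevalM, pevalD) peval_sqnorm -rx; ring.
  have [a b] := par x; have [a' b'] := par' x.
  have := sqN x 1%N; rewrite expr1 => s1.
  by rewrite !(pevalM, pevalD) a b a' b' s1; split; ring.
Qed.

(** The mean of [(A + r B)^2] and [(A - r B)^2] is [A^2 + r^2 B^2], which is polynomial since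
    [r^2 = |x|^2]. Allowing every large [E] lets several certificates share one exponent. *)
Lemma homogenize_sos (F : 'rV[R]_n -> R) : sphere_sos F ->
  exists E0, forall E, (E0 <= E)%N -> exists sg : {mpoly R[n]}, sos sg /\
    forall x r, r != 0 -> r ^+ 2 = dot x x ->
      r ^+ (4 * E) * ((F (r^-1 *: x) + F (- (r^-1 *: x))) / 2) = peval sg x.
Proof.
move=> [s Hs].
have [E0 H] : exists E0, forall E, (E0 <= E)%N -> exists sg : {mpoly R[n]}, sos sg /\
    forall x r, r != 0 -> r ^+ 2 = dot x x -> r ^+ (4 * E) *
      ((\sum_(q <- s) peval q (r^-1 *: x) ^+ 2 +
        \sum_(q <- s) peval q (- (r^-1 *: x)) ^+ 2) / 2) = peval sg x.
  elim: s {Hs} => [|q s [E1 H1]].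
    exists 0%N => E _; exists 0; split; first by exists [::]; rewrite big_nil.
    by move=> x r _ _; rewrite !big_nil addr0 mul0r mulr0 peval0.
  have [E2 H2] := homogenize_parity q.
  exists (maxn E1 E2) => E; rewrite geq_max => /andP[/H1[sg [ssg Hsg]] /H2[A [B [AB par]]]].
  exists (A ^+ 2 + sqnorm R n ^+ 1 * B ^+ 2 + sg); split.
    apply: sosD => //; apply: sosD; first exact: sos_sqr.
    by apply: sosM; [apply: sos_sqnormX | apply: sos_sqr].
  move=> x r r0 rx; rewrite !big_cons !(pevalD, pevalM, pevalXn) peval_sqnorm -(Hsg x r) //.
  have [a b] := par x.
  have rx' : r ^+ 2 = dot (- x) (- x) by rewrite dotNl dotNr opprK.
  have e1 := AB x r r0 rx; have e2 := AB (- x) r r0 rx'.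
  rewrite a b scalerN in e2.
  have E4 : r ^+ (4 * E) = (r ^+ (2 * E)) ^+ 2 by rewrite -exprM; congr (_ ^+ _); lia.
  rewrite expr1 -rx E4; set S1 := \sum_(_ <- _) _; set S2 := \sum_(_ <- _) _.
  transitivity (((r ^+ (2 * E) * peval q (r^-1 *: x)) ^+ 2 +
    (r ^+ (2 * E) * peval q (- (r^-1 *: x))) ^+ 2) / 2 +
    (r ^+ (2 * E)) ^+ 2 * ((S1 + S2) / 2)); first by field.
  by rewrite e1 e2; field.
exists E0 => E /H[sg [ssg Hsg]]; exists sg; split=> // x r r0 rx.
rewrite -(Hsg x r) //.
have u1 : dot (r^-1 *: x) (r^-1 *: x) = 1.
  by rewrite dotZl dotZr -rx; field.
by rewrite !Hs // dotNl dotNr opprK.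
Qed.

Lemma sphere_qm_homogenize m (f : {mpoly R[n]}) (g : m.-tuple {mpoly R[n]}) :
  even_form f -> (forall j, even_form (tnth g j)) -> sphere_qm g (peval f) ->
  exists k, quadratic_module g (sqnorm R n ^+ k * f).
Proof.
move=> [df evf fh] g_form [s0 [s [h0 hs H]]].
(* For [n = 0] the sphere is empty and the certificate on it says nothing; there [sqnorm] is 0 and
   [k = 1] will do. *)
have [n0|n0] := posnP n.
  exists 1%N, 0, (fun=> 0); have sos0 : sos (0 : {mpoly R[n]}) by exists [::]; rewrite big_nil.
  split=> //; rewrite big1 => [|j _]; last by rewrite mulr0.
  by rewrite /sqnorm big1 ?expr1 ?mul0r ?addr0 // => i _; have := ltn_ord i; lia.
have Hex j : exists d, ~~ odd d /\ tnth g j \is d.-homog by have [d ? ?] := g_form j; exists d.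
have [d Hd] := boolp.choice Hex.
have [E0 HE0] := homogenize_sos h0.
have [Es HEs] := boolp.choice (fun j => homogenize_sos (hs j)).
pose E := maxn E0 (\max_j Es j).
pose G := maxn df./2 (\max_j (d j)./2).
have [sg0 [ssg0 Hsg0]] := HE0 E (leq_maxl _ _).
have HEj j : (Es j <= E)%N by rewrite leq_max leq_bigmax ?orbT.
have [sg Hsg] := boolp.choice (fun j => HEs j E (HEj j)).
have Gj j : ((d j)./2 <= G)%N.
  by rewrite leq_max (leq_bigmax (F := fun j => (d j)./2)) orbT.
have Gf : (df./2 <= G)%N by rewrite leq_maxl.
have even_eval p e x r : ~~ odd e -> p \is e.-homog -> r != 0 -> r ^+ 2 = dot x x ->
    forall D, (e./2 <= D)%N ->
    r ^+ (2 * D) * peval p (r^-1 *: x) = dot x x ^+ (D - e./2) * peval p x.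
  move=> ev ph r0 rx D eD; rewrite (peval_homog _ _ ph) mulrA -rx -exprM.
  have eE : e = (e./2).*2 by rewrite -[LHS]odd_double_half (negPf ev).
  have -> : (2 * D = 2 * (D - e./2) + e)%N by rewrite {2}eE; lia.
  by congr (_ * _); rewrite exprD -mulrA -exprMn divff // expr1n mulr1.
have even_opp p e x : ~~ odd e -> p \is e.-homog -> peval p (- x) = peval p x.
  move=> ev ph; rewrite -scaleN1r (peval_homog _ _ ph).
  by rewrite -signr_odd (negPf ev) expr0 mul1r.
(* The factor [r^(4E)] clears the certificates and [r^(2G)] the forms; [f] itself absorbs [r^df]. *)
pose k := (2 * E + (G - df./2))%N.
pose P := sqnorm R n ^+ k * f -
  (sqnorm R n ^+ G * sg0 + \sum_j tnth g j * (sqnorm R n ^+ (G - (d j)./2) * sg j)).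
suff P0 : P = 0.
  exists k, (sqnorm R n ^+ G * sg0), (fun j => sqnorm R n ^+ (G - (d j)./2) * sg j).
  split=> [|j|]; last by apply/eqP; rewrite -subr_eq0 -/P P0.
    by apply: sosM => //; apply: sos_sqnormX.
  by apply: sosM; [apply: sos_sqnormX | have [] := Hsg j].
have sq0 : sqnorm R n != 0.
  apply/eqP => s0'; have := peval_sqnorm (delta_mx 0 (Ordinal n0) : 'rV[R]_n).
  rewrite s0' peval0 => /esym/eqP; rewrite dot_eq0 => /eqP/rowP/(_ (Ordinal n0))/eqP.
  by rewrite !mxE !eqxx oner_eq0.
(* The comparison with the sphere requires [x != 0]; the extra factor [sqnorm] takes care of the
   origin. *)
apply: (mulfI sq0); rewrite mulr0; apply: peval_eq0 => x.
rewrite pevalM peval_sqnorm; have [->|x0] := eqVneq x 0; first by rewrite dot0l mul0r.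
rewrite [X in _ * X](_ : _ = 0) ?mulr0 //; apply/eqP; rewrite pevalB subr_eq0; apply/eqP.
pose r := Num.sqrt (dot x x).
have rx : r ^+ 2 = dot x x by rewrite sqr_sqrtr // dot_ge0.
have r0 : r != 0 by rewrite gt_eqF // sqrtr_gt0 dot_gt0.
pose u := r^-1 *: x.
have u1 : dot u u = 1 by rewrite dotZl dotZr -rx; field.
have Nu1 : dot (- u) (- u) = 1 by rewrite dotNl dotNr opprK.
have [gev gh] : (forall j, ~~ odd (d j)) /\ (forall j, tnth g j \is (d j).-homog).
  by split=> j; have [] := Hd j.
have fu : peval f u = (s0 u + s0 (- u)) / 2 +
    \sum_j peval (tnth g j) u * ((s j u + s j (- u)) / 2).
  have fN : peval f (- u) = s0 (- u) + \sum_j peval (tnth g j) u * s j (- u).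
    rewrite H //; congr (_ + _); apply: eq_bigr => j _.
    by rewrite (even_opp _ _ _ (gev j) (gh j)).
  have -> : peval f u = (peval f u + peval f (- u)) / 2.
    by rewrite (even_opp _ _ _ evf fh); field.
  have -> : \sum_j peval (tnth g j) u * ((s j u + s j (- u)) / 2) =
      (\sum_j peval (tnth g j) u * s j u + \sum_j peval (tnth g j) u * s j (- u)) / 2.
    rewrite -big_split mulr_suml; apply: eq_bigr => j _ /=; ring.
  by rewrite H // fN; field.
rewrite pevalM pevalD !pevalM !pevalXn peval_sqnorm peval_sum.
have fE := even_eval _ _ _ _ evf fh r0 rx _ Gf.
have -> : dot x x ^+ k * peval f x = r ^+ (4 * E) * (r ^+ (2 * G) * peval f u).
  by rewrite fE exprD -{1}rx -exprM mulrA; congr (_ ^+ _ * _ * _); lia.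
rewrite fu -(Hsg0 x r) // -/u mulrDr mulrDr.
have -> : dot x x ^+ G = r ^+ (2 * G) by rewrite -rx -exprM.
congr (_ + _); first by ring.
rewrite !mulr_sumr; apply: eq_bigr => j _.
have [_ Hj] := Hsg j; rewrite !pevalM pevalXn peval_sqnorm -(Hj x r) // -/u.
have gE := even_eval _ _ _ _ (gev j) (gh j) r0 rx _ (Gj j).
set S := s j u + s j (- u).
transitivity (r ^+ (4 * E) * (r ^+ (2 * G) * peval (tnth g j) u) * (S / 2)); first by ring.
by rewrite gE; ring.
Qed.

End Homogenization.

Theorem theorem5p2 (R : realType) (n m : nat)
    (f : {mpoly R[n]}) (g : m.-tuple {mpoly R[n]})
    (f_form : even_form f)
    (g_form : forall j : 'I_m, even_form (tnth g j))
    (f_ge0 : forall u : 'rV[R]_n, basic_closed_set g u -> 0 <= peval f u)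
    (optimality : forall u : 'rV[R]_n, minimizer f (sphere_constraints g) u ->
       [/\ LICQC (sphere_constraints g) u,
           SCC f (sphere_constraints g) u
         & SOSC f (sphere_constraints g) u]) :
  exists k : nat, quadratic_module g (sqnorm R n ^+ k * f).
Proof.
exact: sphere_qm_homogenize f_form g_form (sphere_qm_form f_form g_form f_ge0 optimality).
Qed.
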